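(* Let $n\ge1$ and let $q$ be a prime power. The number of real conjugacy classes in $PGL_n(q)$ is given by $$\sum_{|\nu|=n}\frac{1}{2^{\sigma_\nu}}\prod_{n_i>0}n_{q,n_i},$$ where the sum is over all partitions $\nu=1^{n_1}2^{n_2}\cdots$ of $n$ and, writing $d=|\gcd(n_1,n_2,\dots)|_2$, $\sigma_\nu$ equals $0$ if $|dq|_2>1$ and equals $1$ otherwise. Furthermore, all real conjugacy classes in $PGL_n(q)$ are strongly real.
   Context: An element $g$ of a group $G$ is real if $hgh^{-1}=g^{-1}$ for some $h\in G$, and strongly real if $h$ can be chosen with $h^2=1$; a class is (strongly) real if its elements are. For a positive integer $k$, $|k|_2$ denotes the largest power of $2$ dividing $k$. The notation $\nu=1^{n_1}2^{n_2}\cdots$ means the partition with $n_i$ parts equal to $i$; $|\nu|=\sum_i i n_i$. For $d\ge1$, $n_{q,d}$ is the number of polynomials $f\in\mathbb{F}_q[t]$ of degree $d$ with $f(0)=1$ that are self-reciprocal (the list of roots with multiplicity in the algebraic closure equals the list of inverses of the roots). Explicitly: $n_{q,d}=2q^{(d-1)/2}$ if $q$ odd, $d$ odd; $(q+1)q^{d/2-1}$ if $q$ odd, $d$ even; $q^{(d-1)/2}$ if $q$ even, $d$ odd; $q^{d/2}$ if $q$ even, $d$ even. *)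

(* Defs.v *)
From HB Require Import structures.
From mathcomp Require Import all_boot all_order all_algebra.
From mathcomp Require Import all_fingroup all_solvable all_field.
Set Implicit Arguments.
Unset Strict Implicit.
Unset Printing Implicit Defensive.
Import GRing.Theory.

Section RealElements.
Local Open Scope group_scope.
Variable gT : finGroupType.
Implicit Types (G C : {set gT}) (g : gT).

Definition real_elt G g : bool := [exists h in G, h * g * h^-1 == g^-1].

(* h = 1 is allowed, as the condition is only h ^ 2 = 1. *)
Definition strongly_real_elt G g : bool :=
  [exists h in G, (h ^+ 2 == 1) && (h * g * h^-1 == g^-1)].

Definition real_class G C : bool := [forall g in C, real_elt G g].

Definition strongly_real_class G C : bool :=
  [forall g in C, strongly_real_elt G g].
End RealElements.

(* {'GL_n[F]} consists of matrices of size n.-1.+1, which is n for 0 < n.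
   The center 'Z('GL_n[F]) is the group of nonzero scalar matrices. *)
Definition PGL (n : nat) (F : finFieldType) :
    {group coset_of ('Z('GL_n[F]))%g} :=
  ('GL_n[F] / 'Z('GL_n[F]))%G.

Section SelfReciprocal.
Local Open Scope ring_scope.
Variable F : finFieldType.

Definition alg_closure : countClosedFieldType :=
  projT1 (countable_algebraic_closure F).

Definition to_alg_closure : {rmorphism F -> alg_closure} :=
  sval (projT2 (countable_algebraic_closure F)).

(* Roots with multiplicity, in an arbitrary order; hence the comparison up to
   permutation below. *)
Definition closure_roots (f : {poly F}) : seq alg_closure :=
  sval (closed_field_poly_normal (map_poly to_alg_closure f)).

Definition self_reciprocal (f : {poly F}) : bool :=
  perm_eq (closure_roots f) [seq z^-1 | z <- closure_roots f].

Definition num_self_reciprocal (d : nat) : nat :=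
  #|[set f : {poly_d.+1 F} |
      [&& size (f : {poly F}) == d.+1,
          (f : {poly F}).[0] == 1 & self_reciprocal f]]|.

End SelfReciprocal.

(* nu = 1^(n_1) 2^(n_2) ... is encoded by its multiplicities, with
   nu i = n_(i+1); each n_i is at most n when |nu| = n, and n_i = 0 for
   i > n, so this finite type contains all partitions of n. *)
Definition multiplicities (n : nat) := {ffun 'I_n -> 'I_n.+1}.

Definition weight (n : nat) (nu : multiplicities n) : nat :=
  \sum_(i < n) i.+1 * nu i.

Definition sigma (q n : nat) (nu : multiplicities n) : nat :=
  let d := (\big[gcdn/0]_(i < n) (nu i : nat))`_2 in
  if 1 < (d * q)`_2 then 0 else 1.

(* Main.v *)
Require Import Defs.
From HB Require Import structures.
From mathcomp Require Import all_boot all_order all_algebra.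
From mathcomp Require Import all_fingroup all_solvable all_field.
From mathcomp Require Import zify ring.
From Stdlib Require Import Classical.

(** Real classes of PGL_n are counted in GL_n. In a finite group, the number
    of classes preserved by a map phi commuting with conjugation is the number
    of pairs (x, y) with x ^ y = phi x, divided by the order of the group
    (card_fixed_classes). A pair in GL_n becomes a pair with x ^ y = x^-1 in
    PGL_n exactly when x ^ y = lam x^-1 for a scalar lam, which is then unique.
    Hence q - 1 times the number of real classes of PGL_n is the sum, over the
    multipliers lam <> 0, of the number R_lam of classes of GL_n whose elements
    x are conjugate to lam x^-1 (central_quotient_real_classes).

    The conjugacy class of A is the isomorphism type of F^n as an F[t]-module
    with t acting as A. It is given by the invariant factors (existence:
    structure_theorem; uniqueness: invariant_factors_unique), which are written
    d_i = u_i u_(i+1) ... with unrestricted polynomials u_j of constant term 1;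
    their degrees are the multiplicities in a partition of n. Passing from A
    to lam A^-1 keeps the generators of the module and replaces each polynomial
    p by t^(deg p) p(lam / t), normalised (recip_decomposes). This operation is
    multiplicative, so R_lam counts the tuples in which every u_j is fixed by
    it, and is a sum over partitions of products of the numbers of polynomials
    of each degree that are fixed.

    For lam = 1 those are the self-reciprocal polynomials. Rescaling
    coefficients shows that in degree d there are as many for lam as for 1 when
    lam is a square or d is even; when lam is not a square and d is odd there
    are none. Averaging over lam thus gives the factor 1 when all squares occur
    (q even) or all parts n_i are even, and 1/2 otherwise
    (sum_num_recip_fixed).

    Finally, if A is conjugate to lam A^-1, the two modules have the same
    invariant factors on the same generators. The isomorphism that fixes the
    generators is an involution conjugating A to lam A^-1, so every real
    element is strongly real (similar_involution). *)

Set Implicit Arguments.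
Unset Strict Implicit.
Unset Printing Implicit Defensive.
Import GRing.Theory.
Local Open Scope ring_scope.

(** * Finitely generated torsion modules over F[t] *)

Section Normalised.
Variable F : fieldType.

Lemma dvdp_const1 (a b : {poly F}) : a %| b -> b %| a -> a`_0 = 1 -> b`_0 = 1 -> a = b.
Proof.
move=> ab ba a1 b1; have /eqpP[[x y] /= /andP[x0 y0] e] : a %= b by rewrite /eqp ab.
have := congr1 (fun p : {poly F} => p`_0) e; rewrite !coefZ a1 b1 !mulr1 => xy.
by move: e; rewrite xy; apply: scalerI.
Qed.

Lemma coef0_neq0 (p : {poly F}) : p`_0 = 1 -> p != 0.
Proof. by move=> p1; apply: contra_eq_neq p1 => ->; rewrite coef0 eq_sym oner_eq0. Qed.

End Normalised.

Section Structure.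
Variables (F : fieldType) (V : lmodType {poly F}).
Implicit Types (p q d : nat -> {poly F}) (v w : nat -> V).

Definition lincomb k p v : V := \sum_(i < k) p i *: v i.

Definition spans k v x := exists p, x = lincomb k p v.

(** Largest factor first, so that the quotients d_i / d_(i+1) can later serve
    as free parameters. *)
Definition chain k d := forall i j, (i <= j < k)%N -> d j %| d i.

(** The map sending (p_i) to the sum of the p_i v_i identifies V with the
    direct sum of the F[t]/(d_i). Stating this through generators and
    relations avoids quotient types, and keeps the generators available for
    building module maps. *)
Definition decomposes k d v :=
  (forall x, spans k v x) /\
  (forall p, lincomb k p v = 0 <-> forall i, (i < k)%N -> d i %| p i).

Definition update (T : Type) k (v : nat -> T) x : nat -> T :=
  fun i => if i == k then x else v i.

Lemma eq_lincomb k p q v w : (forall i, (i < k)%N -> p i *: v i = q i *: w i) ->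
  lincomb k p v = lincomb k q w.
Proof. by move=> e; apply: eq_bigr => i _; exact: e. Qed.

Lemma lincombS k p v : lincomb k.+1 p v = lincomb k p v + p k *: v k.
Proof. exact: big_ord_recr. Qed.

Lemma lincomb_updatev k p v x : lincomb k p (update k v x) = lincomb k p v.
Proof. by apply: eq_lincomb => i ik; rewrite /update ltn_eqF. Qed.

Lemma lincomb_updatep k p v a : lincomb k (update k p a) v = lincomb k p v.
Proof. by apply: eq_lincomb => i ik; rewrite /update ltn_eqF. Qed.

Lemma update_same (T : Type) k (v : nat -> T) x : update k v x k = x.
Proof. by rewrite /update eqxx. Qed.

Lemma lincombD k p q v : lincomb k (fun i => p i + q i) v = lincomb k p v + lincomb k q v.
Proof. by rewrite /lincomb -big_split; apply: eq_bigr => i _; rewrite scalerDl. Qed.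

Lemma lincombZ k a p v : lincomb k (fun i => a * p i) v = a *: lincomb k p v.
Proof. by rewrite /lincomb scaler_sumr; apply: eq_bigr => i _; rewrite scalerA. Qed.

Lemma lincombB k p q v : lincomb k (fun i => p i - q i) v = lincomb k p v - lincomb k q v.
Proof.
rewrite -scaleN1r -lincombZ -lincombD; apply: eq_lincomb => i _.
by rewrite mulN1r.
Qed.

Lemma lincomb_unit k i v : (i < k)%N -> lincomb k (fun j => (j == i)%:R) v = v i.
Proof.
move=> ik; rewrite /lincomb (bigD1 (Ordinal ik)) //= eqxx scale1r big1 ?addr0 //.
move=> j; rewrite -val_eqE /= => /negPf->; exact: scale0r.
Qed.

Lemma lincomb_coord k i a v : (i < k)%N -> lincomb k (fun j => a * (j == i)%:R) v = a *: v i.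
Proof. by move=> ik; rewrite lincombZ lincomb_unit. Qed.

Lemma spans_unit k i v : (i < k)%N -> spans k v (v i).
Proof. by move=> ik; exists (fun j => (j == i)%:R); rewrite lincomb_unit. Qed.

Lemma spans_lincomb k p v w : (forall i, (i < k)%N -> spans k v (w i)) ->
  forall m, (m <= k)%N -> spans k v (lincomb m p w).
Proof.
move=> h; elim=> [|m IH] mk.
  by exists (fun=> 0); rewrite /lincomb big_ord0 big1 // => i _; rewrite scale0r.
have [q e] := IH (ltnW mk); have [r e'] := h m mk.
by exists (fun i => q i + p m * r i); rewrite lincombS lincombD e lincombZ -e'.
Qed.

Lemma spans_sub k v w : (forall i, (i < k)%N -> spans k v (w i)) ->
  forall x, spans k w x -> spans k v x.
Proof. by move=> h x [p ->]; apply: spans_lincomb. Qed.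

Definition same_span k v w := forall x, spans k v x <-> spans k w x.

Lemma spans_update k w y : spans k w y ->
  same_span k.+1 w (update k w (w k + y)).
Proof.
move=> hy x; split; apply: spans_sub => i; rewrite ltnS leq_eqVlt => /orP[/eqP->|ik].
- case: hy => q ->; exists (update k (fun i => - q i) 1).
  rewrite lincombS lincomb_updatep lincomb_updatev !update_same scale1r.
  have -> : lincomb k (fun i => - q i) w = - lincomb k q w.
    by rewrite /lincomb -sumrN; apply: eq_bigr => j _; rewrite scaleNr.
  by rewrite addrC addrK.
- have -> : w i = update k w (w k + y) i by rewrite /update ltn_eqF.
  by apply: spans_unit; rewrite ltnS ltnW.
- case: hy => q ->; exists (update k q 1).
  by rewrite lincombS lincomb_updatep !update_same scale1r addrC.
- have -> : update k w (w k + y) i = w i by rewrite /update ltn_eqF.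
  by apply: spans_unit; rewrite ltnS ltnW.
Qed.

Definition swap (T : Type) i j (v : nat -> T) : nat -> T :=
  fun l => if l == i then v j else if l == j then v i else v l.

Lemma lincomb_swap k i p v : (i <= k)%N ->
  lincomb k.+1 (swap i k p) (swap i k v) = lincomb k.+1 p v.
Proof.
move=> ik; have ik' : (i < k.+1)%N by [].
rewrite /lincomb (reindex_inj (@perm_inj _ (tperm (Ordinal ik') ord_max))) /=.
apply: eq_bigr => l _; rewrite /swap.
case: tpermP => [->|->|] /=; rewrite ?eqxx //.
  by case: eqP => [->|].
move=> /eqP; rewrite -val_eqE => /= /negPf-> /eqP; rewrite -val_eqE.
by move=> /= /negPf->.
Qed.

Lemma swapK (T : Type) i j (v : nat -> T) l : swap i j (swap i j v) l = v l.
Proof.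
rewrite /swap eqxx; case: (l =P i) => [->|_].
  by case: (j =P i) => [->|]; rewrite // eqxx.
by case: (l =P j) => [->|] //; rewrite eqxx.
Qed.

Lemma spans_swap k i v : (i <= k)%N -> same_span k.+1 v (swap i k v).
Proof.
move=> ik x; split=> [[p ->]|[p ->]].
  by exists (swap i k p); rewrite lincomb_swap.
exists (swap i k p); rewrite -[RHS](lincomb_swap _ _ ik).
by apply: eq_lincomb => j _; rewrite swapK.
Qed.

(** The predicates minimised below quantify over infinitely many families, so
    the least witness is obtained classically. *)
Lemma ex_minimal (P : nat -> Prop) : (exists n, P n) ->
  exists2 n, P n & forall m, P m -> (n <= m)%N.
Proof.
move=> [n]; elim/ltn_ind: n => n IH Pn.
have [[m [mn Pm]]|h] := classic (exists m, (m < n)%N /\ P m); first exact: IH Pm.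
exists n => // m Pm; rewrite leqNgt; apply/negP => mn.
by apply: h; exists m.
Qed.

Lemma chainP k d : (forall i, (i.+1 < k)%N -> d i.+1 %| d i) -> chain k d.
Proof.
move=> h i j /andP[/subnKC <-]; elim: (j - i)%N => [|l IH]; first by rewrite addn0.
by rewrite addnS => lk; apply: dvdp_trans (h _ lk) (IH (ltnW lk)).
Qed.

Section Step.
Variables (k : nat) (v : nat -> V).

(** A nontrivial relation is recorded by its last coefficient only: swapping
    two generators moves any coefficient there. *)
Definition last_relation w p :=
  [/\ same_span k.+1 v w, lincomb k.+1 p w = 0 & p k != 0].

Variable m : nat.
Hypothesis m_min :
  forall w p, last_relation w p -> (m <= size (p k))%N.

(** A smaller nonzero coefficient could be swapped into last position,
    contradicting minimality of m. *)
Lemma relation_size w p i : same_span k.+1 v w -> lincomb k.+1 p w = 0 ->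
  (i <= k)%N -> (size (p i) < m)%N -> p i = 0.
Proof.
move=> sw e ik sp; apply/eqP/negPn/negP => pn0.
have pk : swap i k p k = p i by rewrite /swap eqxx; case: eqP => [->|].
have : (m <= size (swap i k p k))%N.
  apply: (@m_min (swap i k w)); split; last by rewrite pk.
    by move=> x; rewrite sw; apply: spans_swap.
  by rewrite lincomb_swap.
by rewrite pk leqNgt sp.
Qed.

(** Divide every coefficient by the last one, p_k, and absorb the quotients
    into the last generator: x = w_k + sum of q_i w_i. The remainders are
    coefficients of a relation between generators of the same module, so by
    minimality they vanish, and what is left of the relation is p_k x = 0. *)
Lemma relation_split w p : last_relation w p -> size (p k) = m ->
  exists x, [/\ p k *: x = 0, same_span k.+1 v (update k w x) &
    forall i, (i < k)%N -> p k %| p i].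
Proof.
move=> [sw e pk] sz; pose q i := p i %/ p k; pose r i := p i %% p k.
pose x := w k + lincomb k q w.
have sw' : same_span k.+1 v (update k w x).
  move=> y; rewrite sw; apply: spans_update; by exists q.
have e' : lincomb k.+1 (update k r (p k)) (update k w x) = 0.
  rewrite lincombS lincomb_updatep lincomb_updatev !update_same -e lincombS /x scalerDr -lincombZ.
  rewrite addrCA addrC; congr (_ + _); rewrite -lincombD; apply: eq_lincomb => i _.
  by rewrite addrC (mulrC (p k)) -divp_eq.
have r0 i : (i < k)%N -> r i = 0.
  move=> ik; have := relation_size sw' e' (ltnW ik).
  by rewrite /update ltn_eqF // -sz ltn_modp; apply.
exists x; split=> //; last by move=> i ik; apply/modp_eq0P/r0.
move: e'; rewrite lincombS lincomb_updatep lincomb_updatev !update_same.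
rewrite [lincomb _ _ _]big1 ?add0r // => i _.
by rewrite r0 ?scale0r.
Qed.

End Step.

(** Euclid's algorithm on relations. Among all generating families of length
    k+1 take a relation whose last coefficient a is nonzero of least degree. Then
    a kills the modified last generator x, and a divides the coefficient of x
    in every relation, so x splits off as F[t]/(a); the other generators are
    treated by induction. Minimality also makes a divide all the other
    invariant factors, so it comes last in the chain. The annihilator N
    provides the first relation. *)
Theorem structure_theorem (N : {poly F}) k v :
  N != 0 -> (forall x : V, N *: x = 0) ->
  exists d v', [/\ same_span k v v',
    forall p, lincomb k p v' = 0 <-> forall i, (i < k)%N -> d i %| p i,
    chain k d &
    forall i, (i < k)%N -> d i != 0].
Proof.
move=> N0 NV; elim: k v => [|k IH] v.
  by exists (fun=> 1), v; split=> [//|p|i j|//]; rewrite ?ltn0 ?andbF // /lincomb big_ord0.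
have [m [w [p [rwp sz]]] mmin] : exists2 m,
    exists w p, last_relation k v w p /\ size (p k) = m &
    forall m', (exists w p, last_relation k v w p /\ size (p k) = m') -> (m <= m')%N.
  apply: ex_minimal; exists (size N), v, (fun i => N * (i == k)%:R).
  by rewrite eqxx mulr1; split=> //; split; rewrite ?lincomb_coord ?eqxx ?mulr1.
have m_min w' p' : last_relation k v w' p' -> (m <= size (p' k))%N.
  by move=> h; apply: mmin; exists w', p'.
have [_ _ pk0] := rwp.
have [x [px0 sx _]] := relation_split m_min rwp sz.
(* Subtracting a multiple of a x = 0 reduces the last coefficient modulo a. *)
have dvd_rel w' p' : same_span k.+1 v w' -> lincomb k.+1 p' w' = 0 -> p k *: w' k = 0 ->
    p k %| p' k.
  move=> sw' e' pw'; apply/modp_eq0P.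
  have := @relation_size _ _ _ m_min w' (update k p' (p' k %% p k)) k sw' _ (leqnn _).
  rewrite update_same -sz ltn_modp; apply=> //.
  rewrite lincombS lincomb_updatep update_same -e' lincombS.
  congr (_ + _); rewrite [in RHS](divp_eq (p' k) (p k)) scalerDl -scalerA pw'.
  by rewrite scaler0 add0r.
have [d [v' [sv' kerv' chd d0]]] := IH w.
have sv : same_span k.+1 v (update k v' x).
  move=> y; rewrite sx; split; apply: spans_sub => i; rewrite ltnS leq_eqVlt => /orP[/eqP->|ik].
  - by rewrite update_same -[X in spans _ _ X](update_same k v' x); apply: spans_unit.
  - rewrite /update ltn_eqF //.
    have /sv'[q ->] : spans k w (w i) by apply: spans_unit.
    exists (update k q 0).
    by rewrite lincombS lincomb_updatep lincomb_updatev update_same scale0r addr0.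
  - by rewrite update_same -[X in spans _ _ X](update_same k w x); apply: spans_unit.
  - rewrite /update ltn_eqF //.
    have /sv'[q ->] : spans k v' (v' i) by apply: spans_unit.
    exists (update k q 0).
    by rewrite lincombS lincomb_updatep lincomb_updatev update_same scale0r addr0.
exists (update k d (p k)), (update k v' x); split=> // [q||i].
- split=> [e i|h].
    have dk : p k %| q k by apply: (dvd_rel _ _ sv e); rewrite update_same.
    rewrite ltnS leq_eqVlt => /orP[/eqP->|ik]; first by rewrite update_same.
    rewrite {1}/update ltn_eqF //; move: i ik; apply/kerv'.
    move: e; rewrite lincombS update_same lincomb_updatev.
    by rewrite -(divpK dk) -scalerA px0 scaler0 addr0.
  rewrite lincombS update_same lincomb_updatev.
  have /= := h k (ltnSn _); rewrite update_same => dk.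
  rewrite -(divpK dk) -scalerA px0 scaler0 addr0; apply/kerv' => i ik.
  by have := h i (ltnW ik); rewrite /update ltn_eqF //; apply.
- apply: chainP => i; rewrite ltnS leq_eqVlt => /orP[/eqP Ek|ik]; last first.
    by rewrite /update !ltn_eqF ?chd ?leqnSn // ltnW.
  have ik : (i < k)%N by rewrite -Ek.
  rewrite Ek update_same {1}/update ltn_eqF //.
  (* d_i v'_i + a x = 0 is again a relation with the least last coefficient. *)
  pose s := update k (fun j => d i * (j == i)%:R) (p k).
  have rs : last_relation k v (update k v' x) s.
    split=> //; last by rewrite /s update_same.
    rewrite lincombS /s lincomb_updatep lincomb_updatev !update_same px0 addr0; apply/kerv' => j jk.
    by case: eqP => [->|_]; rewrite ?mulr1 ?mulr0 ?dvdp0.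
  have [|_ [_ _]] := relation_split m_min rs; first by rewrite /s update_same.
  by move=> /(_ i ik); rewrite /s update_same /update ltn_eqF // eqxx mulr1.
- rewrite ltnS leq_eqVlt => /orP[/eqP->|ik]; first by rewrite update_same.
  by rewrite /update ltn_eqF // d0.
Qed.
End Structure.

(** * Uniqueness of the invariant factors over a finite field *)

Section Uniqueness.
Variable (F : finFieldType).
Implicit Types (V : finLmodType {poly F}) (d e : nat -> {poly F}).
Implicit Types (a f : {poly F}) (k m : nat).

(** For f = 0 these are the representatives of F[t]/(a); in general, of its
    f-torsion. The bound m only serves to put all of them in one finite type. *)
Definition residues m (f a : {poly F}) : {set {poly_m F}} :=
  [set p : {poly_m F} | (size p < size a)%N && (a %| f * p)].

Definition extend k (h : 'I_k -> {poly F}) (i : nat) : {poly F} := oapp h 0 (insub i).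

Lemma extendE k (h : 'I_k -> {poly F}) (i : 'I_k) : extend h i = h i.
Proof. by rewrite /extend valK. Qed.

(** In the coordinates given by the decomposition, f x = 0 says that d_i
    divides f p_i for each i, so the f-torsion is a product of f-torsions of
    cyclic modules. *)
Lemma card_torsion V k d (v : nat -> V) m f :
  decomposes k d v -> (forall i, (i < k)%N -> d i != 0 /\ (size (d i) <= m)%N) ->
  #|[set x : V | f *: x == 0]| = (\prod_(i < k) #|residues m f (d i)|)%N.
Proof.
move=> [gen ker] sd.
pose S (i : 'I_k) : pred {poly_m F} := mem (residues m f (d i)).
pose g (h : {ffun 'I_k -> {poly_m F}}) := lincomb k (extend (fun i => polyn (h i))) v.
have gE h h' : g h = g h' <-> (forall i : 'I_k, d i %| polyn (h i) - polyn (h' i)).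
  split => [e i|e].
    have /ker/(_ i (ltn_ord i)) : lincomb k (fun i => extend (fun i => polyn (h i)) i
        - extend (fun i => polyn (h' i)) i) v = 0 by rewrite lincombB -/(g h) -/(g h') e subrr.
    by rewrite !extendE.
  apply/eqP; rewrite -subr_eq0 -lincombB; apply/eqP/ker => i ik.
  by rewrite -[i]/(nat_of_ord (Ordinal ik)) !extendE.
have gin : {in family S &, injective g}.
  move=> h h' /familyP hS /familyP h'S /gE e; apply/ffunP => i; apply/val_inj => /=.
  have := hS i; have := h'S i; rewrite !inE => /andP[s1 _] /andP[s2 _].
  apply/eqP; rewrite -subr_eq0; have := e i; apply: contraLR => ne.
  rewrite gtNdvdp //; apply: leq_ltn_trans (size_polyD _ _) _.
  by rewrite size_polyN gtn_max s1 s2.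
have -> : [set x : V | f *: x == 0] = [set g h | h in family S].
  apply/setP => x; rewrite inE; apply/eqP/imsetP => [fx|[h /familyP hS ->]].
    have [p ep] := gen x.
    exists [ffun i : 'I_k => npolyp m (p i %% d i)].
      apply/familyP => i; rewrite ffunE !inE.
      have [dn0 dm] := sd i (ltn_ord i).
      have sz : (size (p i %% d i)%R < size (d i))%N by rewrite ltn_modp.
      rewrite npolypK ?(leq_trans (ltnW sz)) // sz /=.
      have : lincomb k (fun i => f * p i) v = 0 by rewrite lincombZ -ep.
      move/ker/(_ i (ltn_ord i)); rewrite {1}(divp_eq (p i) (d i)) mulrDr.
      by rewrite dvdp_addr // mulrA dvdp_mull.
    rewrite ep; apply/eqP; rewrite -subr_eq0 -lincombB; apply/eqP/ker => i ik.
    rewrite /extend insubT /= ffunE.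
    have [dn0 dm] := sd i ik.
    have sz : (size (p i %% d i)%R < size (d i))%N by rewrite ltn_modp.
    rewrite npolypK ?(leq_trans (ltnW sz)) //.
    by rewrite {1}(divp_eq (p i) (d i)) addrK dvdp_mull.
  rewrite -lincombZ; apply/ker => i ik.
  by have := hS (Ordinal ik); rewrite inE /extend insubT /= => /andP[].
rewrite card_in_imset // card_family foldrE big_map big_enum /=.
by apply: eq_bigr => i _.
Qed.

Lemma card_residues_le m f a : a != 0 -> (size a <= m)%N ->
  (0 < #|residues m f a| <= #|residues m 0 a|)%N.
Proof.
move=> a0 am; apply/andP; split.
  apply/card_gt0P; exists 0; rewrite inE /= size_poly0 mulr0 dvdp0 andbT.
  by rewrite size_poly_gt0.
by apply/subset_leq_card/subsetP => p; rewrite !inE mul0r dvdp0 andbT => /andP[].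
Qed.

Lemma residues_dvd m f a : a %| f -> residues m f a = residues m 0 a.
Proof.
by move=> af; apply/setP => p; rewrite !inE mul0r dvdp0 dvdp_mulr.
Qed.

(** The residue of 1 is killed by f only if a divides f. *)
Lemma residues_full m f a : a != 0 -> (size a <= m)%N ->
  #|residues m f a| = #|residues m 0 a| -> a %| f.
Proof.
move=> a0 am e.
have /eqP : residues m f a == residues m 0 a.
  rewrite eqEcard e leqnn andbT; apply/subsetP => p.
  by rewrite !inE mul0r dvdp0 andbT => /andP[].
move=> {}e; have [a1|a1] := boolP (size a == 1%N).
  by apply: dvdp_trans (dvd1p f); move: a1; rewrite size_poly_eq1 => /andP[].
have sa : (1 < size a)%N by rewrite ltn_neqAle eq_sym a1 size_poly_gt0.
have s1 : (size (1%R : {poly F}) <= m)%N by rewrite size_poly1 (leq_trans _ am) // ltnW.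
have := in_setT (npolyp m 1 : {poly_m F}).
have : npolyp m 1 \in residues m 0 a.
  by rewrite inE npolypK // size_poly1 sa mul0r dvdp0.
by rewrite -e inE npolypK // mulr1 => /andP[].
Qed.

Lemma eq_leq_prod k (a b : nat -> nat) : (forall i, (i < k)%N -> (0 < a i <= b i)%N) ->
  (\prod_(i < k) a i = \prod_(i < k) b i)%N -> forall i, (i < k)%N -> a i = b i.
Proof.
elim: k => [|k IH] ab //; rewrite !big_ord_recr /= => e.
have ab' i : (i < k)%N -> (0 < a i <= b i)%N by move=> ik; apply/ab/ltnW.
have /andP[ak abk] := ab k (ltnSn k).
have le : (\prod_(i < k) a i <= \prod_(i < k) b i)%N.
  by apply: leq_prod => i _; have /andP[] := ab' i (ltn_ord i).
have gt : (0 < \prod_(i < k) a i)%N.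
  by apply: prodn_gt0 => i; have /andP[] := ab' i (ltn_ord i).
have ek : a k = b k.
  apply/eqP; rewrite eqn_leq abk /=.
  rewrite -(leq_pmul2l gt) e leq_mul2r le orbT //.
move=> i; rewrite ltnS leq_eqVlt => /orP[/eqP->//|ik].
apply: IH => //; apply/eqP; rewrite -(eqn_pmul2r ak) {2}ek; exact/eqP.
Qed.

(** Compare the numbers of elements killed by f = d_m. The first m factors
    contribute the same to both decompositions. Each later d_i divides f, so d
    contributes the largest possible number there, namely the full order of
    F[t]/(d_i), and the orders of the two tails agree. Hence e attains the
    maximum in every later factor too, and e_m divides d_m. *)
Lemma decomposes_dvd V k d e (v w : nat -> V) m :
  (forall i, (i < k)%N -> d i != 0) -> (forall i, (i < k)%N -> e i != 0) ->
  chain k d -> decomposes k d v -> decomposes k e w ->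
  (m < k)%N -> (forall i, (i < m)%N -> d i = e i) -> e m %| d m.
Proof.
move=> d0 e0 chd dv ew mk eqde.
pose M := (\sum_(i < k) (size (d i) + size (e i)))%N.
have sM i : (i < k)%N -> (size (d i) <= M)%N /\ (size (e i) <= M)%N.
  move=> ik; rewrite /M (bigD1 (Ordinal ik)) //=; split.
    by rewrite -addnA leq_addr.
  by rewrite addnAC leq_addl.
have cd f := card_torsion f dv (fun i ik => conj (d0 i ik) (sM i ik).1).
have ce f := card_torsion f ew (fun i ik => conj (e0 i ik) (sM i ik).2).
(* The value each factor of e has to attain: the actual one before m, the
   largest possible one from m on. *)
pose a i := if (i < m)%N then #|residues M (d m) (e i)| else #|residues M 0 (e i)|.
have prods (x y : nat -> nat) :
   (\prod_(i < k) (if (i < m)%N then x i else y i) =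
    (\prod_(i < k | (i < m)%N) x i) * (\prod_(i < k | ~~ (i < m)%N) y i))%N.
  rewrite (bigID (fun i : 'I_k => (i < m)%N)) /=; congr (_ * _)%N.
    by apply: eq_bigr => i ->.
  by apply: eq_bigr => i /negPf->.
have gt0 f (c : nat -> {poly F}) (P : pred 'I_k) :
    (forall i, (i < k)%N -> c i != 0) -> (forall i, (i < k)%N -> size (c i) <= M)%N ->
    (0 < \prod_(i < k | P i) #|residues M f (c i)|)%N.
  move=> c0 cM; apply: prodn_cond_gt0 => i _.
  by have /andP[] := card_residues_le f (c0 i (ltn_ord i)) (cM i (ltn_ord i)).
have tail : (\prod_(i < k | ~~ (i < m)%N) #|residues M 0 (d i)| =
             \prod_(i < k | ~~ (i < m)%N) #|residues M 0 (e i)|)%N.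
  have := cd 0; rewrite ce (bigID (fun i : 'I_k => (i < m)%N)) /=.
  rewrite [RHS](bigID (fun i : 'I_k => (i < m)%N)) /=.
  have -> : (\prod_(i < k | (i < m)%N) #|residues M 0 (d i)| =
             \prod_(i < k | (i < m)%N) #|residues M 0 (e i)|)%N.
    by apply: eq_bigr => i im; rewrite eqde.
  move/eqP; rewrite eqn_pmul2l; first by move/eqP.
  by apply: gt0 => // i /sM[].
have : (\prod_(i < k) #|residues M (d m) (e i)| = \prod_(i < k) a i)%N.
  rewrite -ce cd /a (prods (fun i => #|residues M (d m) (e i)|)
    (fun i => #|residues M 0 (e i)|)) -tail.
  rewrite (bigID (fun i : 'I_k => (i < m)%N)) /=.
  congr (_ * _)%N; apply: eq_bigr => i im; first by rewrite (eqde i).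
  by rewrite residues_dvd //; apply: chd; rewrite leqNgt im ltn_ord.
move=> H; pose b i := #|residues M (d m) (e i)|.
apply: (residues_full (e0 m mk) (sM m mk).2).
have -> : #|residues M 0 (e m)| = a m by rewrite /a ltnn.
apply: (@eq_leq_prod k b a) => // i ik; rewrite /b /a.
case: ifP => _.
  by have /andP[-> _] := card_residues_le (d m) (e0 i ik) (sM i ik).2; rewrite leqnn.
exact: card_residues_le (e0 i ik) (sM i ik).2.
Qed.

Theorem invariant_factors_unique V k d e (v w : nat -> V) :
  (forall i, (i < k)%N -> (d i)`_0 = 1) -> (forall i, (i < k)%N -> (e i)`_0 = 1) ->
  chain k d -> chain k e -> decomposes k d v -> decomposes k e w ->
  forall i, (i < k)%N -> d i = e i.
Proof.
move=> d1 e1 chd che dv ew.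
have d0 i ik : d i != 0 := coef0_neq0 (d1 i ik).
have e0 i ik : e i != 0 := coef0_neq0 (e1 i ik).
elim/ltn_ind => m IH mk; apply: dvdp_const1; rewrite ?d1 ?e1 //.
  apply: (decomposes_dvd e0 d0 che ew dv mk) => i im; rewrite IH // (ltn_trans im) //.
apply: (decomposes_dvd d0 e0 chd dv ew mk) => i im; rewrite IH // (ltn_trans im) //.
Qed.
End Uniqueness.

(** * The F[t]-module of a matrix *)

Section MatrixModule.
Variables (R : comNzRingType) (n : nat) (A : 'M[R]_n).

Implicit Types (p q : {poly R}) (x y : 'rV[R]_n).

(** The row space F^n with t acting as right multiplication by A. The action
    is written out as a sum of powers because polynomial evaluation at a
    matrix asks for n > 0, whereas the induction in realisation starts from 0
    x 0 matrices. *)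
Definition fxmod of 'M[R]_n : Type := 'rV[R]_n.

Definition act (p : {poly R}) (x : 'rV[R]_n) : 'rV[R]_n :=
  \sum_(i < size p) p`_i *: (x *m A ^+ i).

Lemma actE m p x : (size p <= m)%N -> act p x = \sum_(i < m) p`_i *: (x *m A ^+ i).
Proof.
move=> pm; rewrite /act (big_ord_widen m (fun i => p`_i *: (x *m A ^+ i))) //.
rewrite [LHS]big_mkcond; apply: eq_bigr => i _.
by case: ltnP => // ip; rewrite nth_default ?scale0r.
Qed.

Lemma actDl x : {morph act^~ x : p q / p + q}.
Proof.
move=> p q; pose m := maxn (size p) (size q).
rewrite (actE (m := m)) ?size_polyD // (actE (m := m) (p := p)) ?leq_maxl //.
rewrite (actE (m := m) (p := q)) ?leq_maxr // -big_split; apply: eq_bigr => i _.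
by rewrite coefD scalerDl.
Qed.

Lemma actDr p : {morph act p : x y / x + y}.
Proof.
move=> x y; rewrite /act -big_split; apply: eq_bigr => i _.
by rewrite mulmxDl scalerDr.
Qed.

Lemma actC c x : act c%:P x = c *: x.
Proof.
rewrite (actE (m := 1)) ?size_polyC_leq1 //.
by rewrite big_ord1 coefC expr0 mulmx1.
Qed.

Lemma actMX p x : act (p * 'X) x = act p (x *m A).
Proof.
rewrite (actE (m := (size p).+1)); last first.
  by rewrite (leq_trans (size_polyMleq _ _)) // size_polyX addn2.
rewrite big_ord_recl coefMX eqxx scale0r add0r; apply: eq_bigr => i _.
by rewrite coefMX /= exprS -mulmxA.
Qed.

Lemma act_mulA p x : act p (x *m A) = act p x *m A.
Proof.
rewrite /act mulmx_suml; apply: eq_bigr => i _.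
rewrite -scalemxAl -!mulmxA; congr (_ *: (_ *m _)).
by rewrite -[RHS]exprSr exprS.
Qed.

Lemma actZl c p x : act (c *: p) x = c *: act p x.
Proof.
rewrite (actE (m := size p)) ?size_scale_leq // /act scaler_sumr.
by apply: eq_bigr => i _; rewrite coefZ scalerA.
Qed.

Lemma actA p q x : act p (act q x) = act (p * q) x.
Proof.
elim/poly_ind: p => [|p c IH] in q x *.
  by rewrite mul0r /act size_poly0 !big_ord0.
rewrite actDl actMX -act_mulA -actMX actC IH mulrDl actDl mul_polyC actZl.
by rewrite (mulrC q) mulrA.
Qed.

HB.instance Definition _ := GRing.Zmodule.on (fxmod A).
HB.instance Definition _ := GRing.Zmodule_isLmodule.Build {poly R} (fxmod A)
  actA (fun x => etrans (actC 1 x) (scale1r x)) (fun p => actDr p) (fun x p q => actDl x p q).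
End MatrixModule.

HB.instance Definition _ (F : finFieldType) n (A : 'M[F]_n) := Finite.on (fxmod A).

Section Theory.
Variable F : fieldType.

Lemma fxmodC n (A : 'M[F]_n) c (x : fxmod A) : c%:P *: x = c *: (x : 'rV_n).
Proof. exact: actC. Qed.

Lemma fxmodX n (A : 'M[F]_n) (x : fxmod A) : 'X *: x = (x : 'rV_n) *m A.
Proof. by rewrite -['X]mul1r [LHS]actMX actC scale1r. Qed.

Lemma fxmod_horner n (A : 'M[F]_n.+1) p (x : fxmod A) :
  p *: x = (x : 'rV_n.+1) *m horner_mx A p.
Proof.
elim/poly_ind: p => [|p c IH]; first by rewrite scale0r rmorph0 mulmx0.
rewrite scalerDl fxmodC rmorphD rmorphM /= horner_mx_C horner_mx_X mulmxDr.
rewrite mulrC -scalerA fxmodX IH -mulmxA; congr (_ + _).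
by rewrite mul_mx_scalar.
Qed.

Lemma fxmod_torsion n (A : 'M[F]_n.+1) (x : fxmod A) : char_poly A *: x = 0.
Proof. by rewrite fxmod_horner Cayley_Hamilton mulmx0. Qed.

(** A matrix intertwining A and B is a morphism of F[t]-modules. *)
Lemma mulmx_fx n (A B X : 'M[F]_n) p (x : fxmod A) : A *m X = X *m B ->
  (p *: x : 'rV_n) *m X = p *: ((x : 'rV_n) *m X : fxmod B) .
Proof.
move=> e; elim/poly_ind: p => [|p c IH] in x *; first by rewrite !scale0r mul0mx.
rewrite !scalerDl mulmxDl !fxmodC scalemxAl; congr (_ + _).
by rewrite -!scalerA !fxmodX IH -!mulmxA e.
Qed.

End Theory.

(** * Similarity and module structure *)

Section Similar.
Variable F : finFieldType.
Implicit Types (d : nat -> {poly F}).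

Lemma mulmx_lincomb n (A B X : 'M[F]_n) k p (v : nat -> fxmod A) : A *m X = X *m B ->
  (lincomb k p v : 'rV_n) *m X = lincomb k p (fun i => (v i : 'rV_n) *m X : fxmod B).
Proof.
move=> e; rewrite /lincomb mulmx_suml; apply: eq_bigr => i _.
exact: mulmx_fx.
Qed.

Lemma similar_decomposes n (A B X : 'M[F]_n) k d (v : nat -> fxmod A) :
  X \in unitmx -> A *m X = X *m B -> decomposes k d v ->
  decomposes k d (fun i => (v i : 'rV_n) *m X : fxmod B).
Proof.
move=> uX e [gen ker]; split=> [x|p].
  have [p ep] := gen ((x : 'rV_n) *m invmx X); exists p.
  by rewrite -mulmx_lincomb // -ep mulmxKV.
rewrite -mulmx_lincomb //; split=> [h|/ker->]; last by rewrite mul0mx.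
by apply/ker; rewrite -[LHS](mulmxK uX) h mul0mx.
Qed.

(** The map sending the sum of the p_i v_i to the sum of the p_i w_i is well
    defined and injective, as both families satisfy the same relations.
    Knowing that X takes v_i to w_i is what later makes X an involution. *)
Lemma decomposes_similar n (A B : 'M[F]_n) k d
    (v : nat -> fxmod A) (w : nat -> fxmod B) :
  decomposes k d v -> decomposes k d w ->
  exists X : 'M_n, [/\ X \in unitmx, A *m X = X *m B &
    forall i, (i < k)%N -> (v i : 'rV_n) *m X = w i].
Proof.
move=> [genv kerv] [genw kerw].
have eqvw p q : lincomb k p v = lincomb k q v <-> lincomb k p w = lincomb k q w.
  split=> /eqP; rewrite -subr_eq0 -lincombB => /eqP.
    by move/kerv/kerw; rewrite lincombB => /eqP; rewrite subr_eq0 => /eqP.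
  by move/kerw/kerv; rewrite lincombB => /eqP; rewrite subr_eq0 => /eqP.
have [f fE] : exists f : 'rV[F]_n -> 'rV[F]_n, forall p, f (lincomb k p v) = lincomb k p w.
  have [x|f fP] := @fin_all_exists 'rV[F]_n (fun=> 'rV[F]_n)
    (fun x y => exists2 p, x = lincomb k p v & y = lincomb k p w).
    by have [p ep] := genv x; exists (lincomb k p w), p.
  by exists f => p; have [q e ->] := fP (lincomb k p v); apply/eqvw.
have f_lin : linear f.
  move=> c x y; have [[p ->] [q ->]] := (genv x, genv y).
  have -> : c *: lincomb k p v + lincomb k q v = lincomb k (fun i => c%:P * p i + q i) v.
    by rewrite lincombD lincombZ fxmodC.
  by rewrite !fE lincombD lincombZ fxmodC.
pose L : {linear 'rV[F]_n -> 'rV[F]_n} :=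
  HB.pack f (GRing.isLinear.Build F 'rV[F]_n 'rV[F]_n _ f f_lin).
have XE x : x *m lin1_mx L = f x by rewrite mul_rV_lin1.
exists (lin1_mx L); split=> [||i ik]; last first.
- by rewrite XE -(lincomb_unit v ik) fE lincomb_unit.
- apply/row_matrixP => i; rewrite !rowE !mulmxA !XE.
  have [p ->] := genv (delta_mx 0 i).
  by rewrite fE -!fxmodX -!lincombZ fE.
rewrite -row_free_unit; apply: inj_row_free => x; rewrite XE.
have [p ->] := genv x; rewrite fE => /kerw h; exact/kerv.
Qed.

(** The standard basis generates, and the characteristic polynomial
    annihilates. *)
Lemma decomposition_exists n (A : 'M[F]_n.+1) : exists d (v : nat -> fxmod A),
  [/\ decomposes n.+1 d v, chain n.+1 d & forall i, (i < n.+1)%N -> d i != 0].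
Proof.
have N0 : char_poly A != 0 by rewrite monic_neq0 ?char_poly_monic.
have [d [v [sv ker chd d0]]] :=
  structure_theorem n.+1 (fun i => delta_mx 0 (inord i) : fxmod A) N0 (@fxmod_torsion _ _ A).
exists d, v; split=> //.
split=> // x; apply/sv; exists (fun i => ((x : 'rV_n.+1) 0 (inord i))%:P).
rewrite {1}[x]row_sum_delta; apply: eq_bigr => i _.
by rewrite fxmodC !inord_val.
Qed.

Lemma dvd_annihilator (V : lmodType {poly F}) k d (v : nat -> V) f i :
  decomposes k d v -> (forall x : V, f *: x = 0) -> (i < k)%N -> d i %| f.
Proof.
move=> [_ ker] h ik.
have /ker/(_ i ik) : lincomb k (fun j => f * (j == i)%:R) v = 0 by rewrite lincomb_coord.
by rewrite eqxx mulr1.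
Qed.

Lemma card_residues0 m (a : {poly F}) : (size a <= m)%N -> a != 0 ->
  #|residues m 0 a| = (#|F| ^ (size a).-1)%N.
Proof.
move=> am a0; rewrite -card_npoly.
have sa : (0 < size a)%N by rewrite size_poly_gt0.
pose g (p : {poly_(size a).-1 F}) : {poly_m F} := npolyp m p.
have gE p : g p = p :> {poly F}.
  by rewrite npolypK // (leq_trans (size_npoly p)) // (leq_trans (leq_pred _)).
have <- : [set g p | p : {poly_(size a).-1 F}] = residues m 0 a.
  apply/setP => p; rewrite inE mul0r dvdp0 andbT.
  apply/imsetP/idP => [[q _ ->]|sp].
    by rewrite gE -{2}(prednK sa) ltnS size_npoly.
  exists (npolyp _ p) => //; apply/val_inj; rewrite /= gE npolypK //.
  by rewrite -ltnS prednK.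
by rewrite card_imset // => p q e; apply/val_inj; rewrite /= -gE e gE.
Qed.

(** Count the vectors: q^n is the product of the orders of the F[t]/(d_i). *)
Lemma decomposes_degree n (A : 'M[F]_n) k d (v : nat -> fxmod A) :
  decomposes k d v -> (forall i, (i < k)%N -> d i != 0) ->
  n = (\sum_(i < k) (size (d i)).-1)%N.
Proof.
move=> dv d0; pose M := (\sum_(i < k) size (d i))%N.
have sM i : (i < k)%N -> d i != 0 /\ (size (d i) <= M)%N.
  by move=> ik; split; [exact: d0 | rewrite /M (bigD1 (Ordinal ik)) //= leq_addr].
have := card_torsion 0 dv sM.
rewrite (eq_bigr (fun i : 'I_k => #|F| ^ (size (d i)).-1)%N); last first.
  by move=> i _; have [? ?] := sM i (ltn_ord i); rewrite card_residues0.
rewrite -expn_sum.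
have -> : [set x : fxmod A | 0 *: x == 0] = [set: 'rV[F]_n].
  by apply/setP => x; rewrite !inE scale0r eqxx.
rewrite cardsT card_mx mul1n => /eqP.
rewrite eqn_exp2l => [/eqP //|]; exact: card_finNzRing_gt1.
Qed.

End Similar.

(** * Matrices with prescribed invariant factors *)

Section Realisation.
Variable F : fieldType.
Implicit Types (d : nat -> {poly F}).

(** Multiplication by t on F[t]/(a), in the basis of powers of t: a companion
    matrix. *)
Definition mulX_mod (a : {poly F}) : 'M[F]_((size a).-1) :=
  lin1_mx (fun x => poly_rV (('X * rVpoly x) %% a)).

Lemma rVpoly_mulX_mod (a : {poly F}) (x : 'rV_((size a).-1)) : a != 0 ->
  rVpoly (x *m mulX_mod a) = ('X * rVpoly x) %% a.
Proof.
move=> a0; pose f (y : 'rV_((size a).-1)) : 'rV_((size a).-1) := poly_rV (('X * rVpoly y) %% a).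
have f_lin : linear f.
  move=> c y z; rewrite /f linearP mulrDr -scalerAr modpD modpZl.
  by rewrite linearP.
pose L : {linear 'rV[F]_((size a).-1) -> 'rV[F]_((size a).-1)} :=
  HB.pack f (GRing.isLinear.Build F 'rV[F]_((size a).-1) 'rV[F]_((size a).-1) _ f f_lin).
have -> : x *m mulX_mod a = f x by rewrite -[f x]/(L x) -mul_rV_lin1.
by rewrite /f poly_rV_K // -ltnS prednK ?size_poly_gt0 // ltn_modp.
Qed.

Lemma rVpoly_cyclic (a p : {poly F}) (x : fxmod (mulX_mod a)) : a != 0 ->
  rVpoly (p *: x) = (p * rVpoly x) %% a.
Proof.
move=> a0; elim/poly_ind: p => [|p c IH] in x *.
  by rewrite scale0r mul0r mod0p linear0.
rewrite scalerDl linearD mulrDl modpD fxmodC linearZ /=; congr (_ + _).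
  rewrite -scalerA IH fxmodX rVpoly_mulX_mod //.
  by rewrite modp_mul mulrA.
rewrite mul_polyC modpZl modp_small //.
by rewrite (leq_ltn_trans (size_poly _ _)) // prednK ?size_poly_gt0.
Qed.

Lemma row_mx_fx n1 n2 (A : 'M[F]_n1) (B : 'M[F]_n2) p (x : fxmod A) (y : fxmod B) :
  p *: (row_mx x y : fxmod (block_mx A 0 0 B)) = row_mx (p *: x : 'rV_n1) (p *: y : 'rV_n2).
Proof.
elim/poly_ind: p => [|p c IH] in x y *; first by rewrite !scale0r row_mx0.
rewrite !scalerDl -!scalerA !fxmodX !fxmodC scale_row_mx.
have -> : row_mx x y *m block_mx A 0 0 B = row_mx ((x : 'rV_n1) *m A) ((y : 'rV_n2) *m B).
  by rewrite mul_row_block !mulmx0 addr0 add0r.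
rewrite IH; exact: add_row_mx.
Qed.

Lemma row_mx_lincomb n1 n2 (A : 'M[F]_n1) (B : 'M[F]_n2) k p
    (v : nat -> fxmod A) (w : nat -> fxmod B) :
  lincomb k p (fun i => row_mx (v i) (w i) : fxmod (block_mx A 0 0 B)) =
  row_mx (lincomb k p v : 'rV_n1) (lincomb k p w : 'rV_n2).
Proof.
elim: k => [|k IH]; first by rewrite /lincomb !big_ord0 row_mx0.
by rewrite !lincombS IH row_mx_fx; exact: add_row_mx.
Qed.

(** Block-diagonal sums of companion matrices. A factor of degree 0
    contributes an empty block. *)
Lemma realisation k d n : (forall i, (i < k)%N -> d i != 0) ->
  n = (\sum_(i < k) (size (d i)).-1)%N ->
  exists (A : 'M[F]_n) (v : nat -> fxmod A), decomposes k d v.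
Proof.
elim: k n => [|k IH] n d0 ->.
  rewrite big_ord0; exists 0, (fun=> 0); split=> [x|p].
    by exists (fun=> 0); rewrite /lincomb big_ord0; apply: (thinmx0 (x : 'rV_0)).
  by rewrite /lincomb big_ord0.
have [|A [v [genv kerv]]] := IH _ _ erefl; first by move=> i /ltnW; apply: d0.
rewrite big_ord_recr /=; set B := mulX_mod (d k).
have dk0 : d k != 0 by apply: d0.
pose e : fxmod B := poly_rV (1 %% d k).
have eE : rVpoly e = 1 %% d k.
  by rewrite poly_rV_K // -ltnS prednK ?size_poly_gt0 // ltn_modp.
have peE p : rVpoly (p *: e) = p %% d k.
  by rewrite rVpoly_cyclic // eE modp_mul mulr1.
pose vw i := row_mx (update k v 0 i) (update k (fun=> 0) e i).
exists (block_mx A 0 0 B), vw.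
have lincombE p : lincomb k.+1 p (vw : nat -> fxmod (block_mx A 0 0 B)) =
    row_mx (lincomb k p v : 'rV__) (p k *: e : 'rV__).
  rewrite row_mx_lincomb; congr row_mx.
    by rewrite lincombS lincomb_updatev update_same scaler0 addr0.
  rewrite lincombS lincomb_updatev update_same [lincomb _ _ _]big1 ?add0r // => i _; exact: scaler0.
split=> [x|p].
  have [p ep] := genv (lsubmx (x : 'rV_(_ + _))).
  exists (update k p (rVpoly (rsubmx (x : 'rV_(_ + _))))).
  rewrite lincombE lincomb_updatep -ep update_same -[LHS]hsubmxK; congr row_mx.
  apply: (can_inj (@rVpolyK _ _)); rewrite peE modp_small //.
  by rewrite (leq_ltn_trans (size_poly _ _)) // prednK ?size_poly_gt0.
rewrite lincombE; split=> [h i|h].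
  have [h1 h2] : lincomb k p v = 0 /\ p k *: e = 0.
    by apply: eq_row_mx; rewrite row_mx0.
  rewrite ltnS leq_eqVlt => /orP[/eqP->|ik]; last exact: (proj1 (kerv p) h1).
  by apply/modp_eq0P; rewrite -peE h2 linear0.
have -> : lincomb k p v = 0 by apply/kerv => i /ltnW; apply: h.
have -> : p k *: e = 0.
  apply: (can_inj (@rVpolyK _ _)); rewrite peE linear0; apply/modp_eq0P.
  exact: h.
exact: row_mx0.
Qed.
End Realisation.

(** * Twisted reciprocal polynomials and the module of lam A^-1 *)

Section Reciprocal.
Variables (F : fieldType) (lam : F).
Hypothesis lam0 : lam != 0.
Implicit Types (p q a : {poly F}) (m : nat) (d : nat -> {poly F}).

(** The polynomial t^m p(lam / t), for p of degree at most m. *)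
Definition revp m p := \poly_(j < m.+1) (p`_(m - j) * lam ^+ (m - j)).

Lemma coef_revp m p j : (revp m p)`_j = if (j <= m)%N then p`_(m - j) * lam ^+ (m - j) else 0.
Proof. by rewrite coef_poly ltnS. Qed.

Lemma size_revp m p : (size (revp m p) <= m.+1)%N.
Proof. exact: size_poly. Qed.

Lemma revpK m p : (size p <= m.+1)%N -> revp m (revp m p) = lam ^+ m *: p.
Proof.
move=> pm; apply/polyP => j; rewrite coef_revp coefZ.
case: leqP => jm; last by rewrite nth_default ?mulr0 // (leq_trans pm).
by rewrite coef_revp leq_subr subKn // -mulrA -exprD subnKC // mulrC.
Qed.

Lemma revpD m : {morph revp m : p q / p + q}.
Proof.
move=> p q; apply/polyP => j; rewrite coefD !coef_revp.
by case: ifP; rewrite ?addr0 // coefD mulrDl.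
Qed.

Lemma revpZ m c p : revp m (c *: p) = c *: revp m p.
Proof.
apply/polyP => j; rewrite coefZ !coef_revp.
by case: ifP; rewrite ?mulr0 // coefZ mulrA.
Qed.

Lemma revp0 m : revp m 0 = 0.
Proof. by apply/polyP => j; rewrite coef_revp !coef0 mul0r if_same. Qed.

Lemma revp_MX m p : revp m.+1 (p * 'X) = lam *: revp m p.
Proof.
apply/polyP => j; rewrite coefZ !coef_revp coefMX.
have [jm|jm|->] := ltngtP j m.+1.
- by rewrite -ltnS jm subSn //= exprS mulrCA.
- by rewrite leqNgt ltnW // mulr0.
- by rewrite subnn ltnn mul0r mulr0.
Qed.

Lemma revp_shift m l p : (size p <= m.+1)%N -> revp (l + m) p = 'X^l * revp m p.
Proof.
move=> pm; apply/polyP => j; rewrite coefXnM !coef_revp.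
case: ltnP => jl.
  by case: ifP => // jm; rewrite nth_default ?mul0r // (leq_trans pm) //; lia.
have -> : (m - (j - l) = l + m - j)%N by lia.
by rewrite leq_subLR.
Qed.

Lemma revp_const m c : revp m c%:P = c *: 'X^m.
Proof.
rewrite -[m]addn0 revp_shift ?size_polyC_leq1 // mulrC -mul_polyC.
congr (_ * _); last by rewrite addn0.
by apply/polyP => -[|j]; rewrite coef_revp !coefC //= mulr1.
Qed.

Lemma revpM m l p q : (size p <= m.+1)%N -> (size q <= l.+1)%N ->
  revp (m + l) (p * q) = revp m p * revp l q.
Proof.
elim/poly_ind: p => [|p c IH] in m *; first by rewrite mul0r !revp0 mul0r.
have [->|p0] := eqVneq p 0.
  rewrite mul0r add0r => _ ql; rewrite revp_const mul_polyC revpZ revp_shift //.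
  by rewrite scalerAl.
case: m => [|m]; rewrite size_MXaddC (negPf p0) /= ltnS => pm ql.
  by rewrite leqn0 size_poly_eq0 (negPf p0) in pm.
rewrite mulrDl !revpD mulrAC addSn !revp_MX mulrDl IH // -scalerAl.
rewrite mul_polyC revpZ -addSn revp_shift // revp_const; congr (_ + _).
exact: scalerAl.
Qed.

(** When p(0) <> 0, the roots of recip p are the lam / z for z a root of p; the
    scalar makes the constant term 1. *)
Definition recip p := (lead_coef p * lam ^+ (size p).-1)^-1 *: revp (size p).-1 p.

Lemma coef_recip p j :
  (recip p)`_j = if (j <= (size p).-1)%N
    then p`_((size p).-1 - j) * lam ^+ ((size p).-1 - j) / (lead_coef p * lam ^+ (size p).-1)
    else 0.
Proof. by rewrite coefZ coef_revp; case: ifP; rewrite ?mulr0 // mulrC. Qed.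

Lemma recip_coef0 p : p != 0 -> (recip p)`_0 = 1.
Proof.
move=> p0; rewrite coef_recip subn0 divff //.
by rewrite mulf_neq0 ?expf_neq0 ?lead_coef_eq0.
Qed.

Lemma size_recip p : p`_0 != 0 -> size (recip p) = size p.
Proof.
move=> p00; have p0 : p != 0 by apply: contra p00 => /eqP->; rewrite coef0.
have sp : (0 < size p)%N by rewrite size_poly_gt0.
apply/eqP; rewrite eqn_leq; apply/andP; split.
  by rewrite (leq_trans (size_scale_leq _ _)) // (leq_trans (size_revp _ _)) ?prednK.
rewrite -(prednK sp); rewrite ltnNge; apply/negP => h.
have : (recip p)`_(size p).-1 != 0.
  rewrite coef_recip leqnn subnn expr0 mulr1.
  by rewrite mulf_neq0 ?invr_eq0 ?mulf_neq0 ?expf_neq0 ?lead_coef_eq0.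
by rewrite nth_default ?eqxx.
Qed.

Lemma recipM p q : p != 0 -> q != 0 -> recip (p * q) = recip p * recip q.
Proof.
move=> p0 q0; rewrite /recip.
have -> : (size (p * q)%R).-1 = ((size p).-1 + (size q).-1)%N.
  rewrite size_mul // -[size p]prednK ?size_poly_gt0 //.
  by rewrite -[size q]prednK ?size_poly_gt0 // addSn addnS.
rewrite revpM ?prednK ?size_poly_gt0 // lead_coefM exprD -scalerAl -scalerAr scalerA.
by rewrite -invfM mulrACA.
Qed.

Lemma recip1 : recip 1 = 1.
Proof.
by rewrite /recip size_poly1 lead_coef1 /= !mul1r invr1 scale1r revp_const scale1r expr0.
Qed.

Lemma recip_eqp p : p != 0 -> recip p %= revp (size p).-1 p.
Proof.
by move=> p0; rewrite eqp_scale // invr_eq0 mulf_neq0 ?expf_neq0 ?lead_coef_eq0.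
Qed.

(** Reversal is multiplicative and, up to a scalar, an involution, so
    divisibility can be reversed. *)
Lemma dvdp_revp a m p : a`_0 != 0 -> (size p <= m.+1)%N ->
  a %| revp m p <-> recip a %| p.
Proof.
move=> a00 pm; have a0 : a != 0 by apply: contra a00 => /eqP->; rewrite coef0.
have sa : (0 < size a)%N by rewrite size_poly_gt0.
have lm0 l : lam ^+ l != 0 by rewrite expf_neq0.
rewrite (eqp_dvdl _ (recip_eqp a0)); set s := (size a).-1.
have [->|p0] := eqVneq p 0; first by rewrite revp0 !dvdp0.
have sas : size a = s.+1 by rewrite prednK.
split=> /dvdpP[e ee].
  have e0 : e != 0.
    apply/eqP => e0; move: ee; rewrite e0 mul0r => /(congr1 (revp m)).
    rewrite revpK // revp0 => /eqP; rewrite scaler_eq0 (negPf (lm0 _)).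
    by rewrite (negPf p0).
  have se : (size e + s <= m.+1)%N.
    by rewrite -[s]/((s.+1).-1) -sas /= -subn1 addnBA // subn1 -size_mul // -ee size_revp.
  have sm : (s <= m)%N.
    rewrite -ltnS (leq_trans _ se) // -add1n leq_add2r size_poly_gt0 //.
  rewrite -(dvdpZr _ _ (lm0 m)) -revpK // ee -(subnK sm) revpM ?sas //.
    exact: dvdp_mull.
  by rewrite -subSn // leq_subRL ?(leq_trans sm) // addnC.
have srev : size (revp s a) = s.+1.
  rewrite -sas -[RHS](size_recip a00); apply: eqp_size; rewrite eqp_sym; exact: recip_eqp.
have e0 : e != 0 by apply: contra p0 => /eqP e0; rewrite ee e0 mul0r.
have se : (size e + s <= m.+1)%N.
  move: pm; rewrite ee size_mul //; last by rewrite -size_poly_eq0 srev.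
  by rewrite srev addnS.
have sm : (s <= m)%N.
  by rewrite -ltnS (leq_trans _ se) // -add1n leq_add2r size_poly_gt0.
rewrite ee -(subnK sm) revpM ?srev //.
  by rewrite revpK ?sas // dvdp_mull // dvdpZr.
by rewrite -subSn // leq_subRL ?(leq_trans sm) // addnC.
Qed.

Section Module.
Variables (n : nat) (A B : 'M[F]_n).
Hypothesis AB : A *m B = lam%:M.

Lemma mulmx_scalarC : B *m A = lam%:M.
Proof.
have e : A *m (lam^-1 *: B) = 1%:M by rewrite -scalemxAr AB scale_scalar_mx mulVf.
have := mulmx1C e; rewrite -scalemxAl => /(congr1 (fun M => lam *: M)).
by rewrite scalerA divff // scale1r scalemx1.
Qed.

(** Multiplying p(lam A^-1) by A^m clears the denominators and gives (t^m
    p(lam / t))(A). *)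
Lemma revp_fx m p (x : 'rV[F]_n) : (size p <= m.+1)%N ->
  'X^m *: ((p *: (x : fxmod B)) : fxmod A) = revp m p *: (x : fxmod A).
Proof.
elim/poly_ind: p => [|p c IH] in m x *; first by rewrite revp0 !scale0r scaler0.
have [->|p0] := eqVneq p 0.
  rewrite mul0r add0r => _; rewrite revp_const -mul_polyC mulrC -scalerA !fxmodC //.
case: m => [|m]; rewrite size_MXaddC (negPf p0) /= ltnS => pm.
  by rewrite leqn0 size_poly_eq0 (negPf p0) in pm.
rewrite scalerDl fxmodC -scalerA fxmodX revpD revp_MX revp_const scalerDl.
transitivity ('X^(m.+1) *: (p *: ((x *m B) : fxmod B) : fxmod A) +
  'X^(m.+1) *: ((c *: x) : fxmod A)).
  exact: scalerDr.
congr (_ + _); last by rewrite -mul_polyC mulrC -scalerA fxmodC.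
rewrite exprS -scalerA IH // scalerA mulrC -scalerA fxmodX -mulmxA mulmx_scalarC.
by rewrite mul_mx_scalar -mul_polyC mulrC -scalerA fxmodC.
Qed.

End Module.

Lemma mulmx_scalar_unit n (A B : 'M[F]_n) : A *m B = lam%:M -> A \in unitmx.
Proof.
move=> AB; have e : A *m (lam^-1 *: B) = 1%:M by rewrite -scalemxAr AB scale_scalar_mx mulVf.
by have [] := mulmx1_unit e.
Qed.

Lemma fxX_bij n (A : 'M[F]_n) m : A \in unitmx ->
  (forall x : fxmod A, exists y : fxmod A, x = 'X^m *: y) /\
  (forall x : fxmod A, 'X^m *: x = 0 -> x = 0).
Proof.
move=> uA; elim: m => [|m [s i]]; split=> x; rewrite ?expr0 ?scale1r //.
- by exists x; rewrite scale1r.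
- have [y ->] := s x; exists ((y : 'rV_n) *m invmx A).
  by rewrite exprSr -scalerA fxmodX mulmxKV.
- rewrite exprSr -scalerA => /i; rewrite fxmodX => h.
  by rewrite -[x](mulmxK uA) h mul0mx.
Qed.

Lemma revp_lincomb n (A B : 'M[F]_n) k m (p : nat -> {poly F}) (v : nat -> 'rV[F]_n) :
  A *m B = lam%:M -> (forall i, (i < k)%N -> size (p i) <= m.+1)%N ->
  'X^m *: (lincomb k p (v : nat -> fxmod B) : fxmod A) =
  lincomb k (fun i => revp m (p i)) (v : nat -> fxmod A).
Proof.
move=> AB; elim: k => [|k IH] sp; first by rewrite /lincomb !big_ord0; exact: scaler0.
rewrite !lincombS -IH; last by move=> i ik; apply/sp/ltnW.
rewrite -(revp_fx AB) ?sp //; exact: scalerDr.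
Qed.

Lemma size_bound k (p : nat -> {poly F}) :
  exists m, (forall i, (i < k)%N -> size (p i) <= m.+1)%N.
Proof.
exists (\sum_(i < k) size (p i))%N => i ik.
by rewrite ltnW // ltnS (bigD1 (Ordinal ik)) //= leq_addr.
Qed.

(** The generators stay the same: polynomials in lam A^-1 and in A span the
    same vectors, and multiplying a relation over lam A^-1 by a high power of
    A turns it into the reversed relation over A. *)
Theorem recip_decomposes n (A B : 'M[F]_n) k d (v : nat -> 'rV[F]_n) :
  A *m B = lam%:M -> (forall i, (i < k)%N -> (d i)`_0 != 0) ->
  decomposes k d (v : nat -> fxmod A) ->
  decomposes k (fun i => recip (d i)) (v : nat -> fxmod B).
Proof.
move=> AB d0 [gen ker]; have BA := mulmx_scalarC AB.
split=> [x|p].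
  have [m sd] := size_bound k d.
  have [/(_ x)[y ->] _] := fxX_bij m (mulmx_scalar_unit BA).
  (* The power m is fixed before y; reducing the coefficients of y modulo the
     d_i keeps their degrees within it. *)
  have [p ->] := gen y; pose r i := p i %% d i.
  have -> : lincomb k p (v : nat -> fxmod A) = lincomb k r (v : nat -> fxmod A).
    apply/eqP; rewrite -subr_eq0 -lincombB; apply/eqP/ker => i ik.
    by rewrite {1}(divp_eq (p i) (d i)) addrK dvdp_mull.
  exists (fun i => revp m (r i)); apply: revp_lincomb => // i ik.
  rewrite (leq_trans _ (sd i ik)) // ltnW // ltn_modp.
  by apply: contra (d0 i ik) => /eqP->; rewrite coef0.
have [m sp] := size_bound k p.
have [_ inj] := fxX_bij m (mulmx_scalar_unit AB).
transitivity (lincomb k (fun i => revp m (p i)) (v : nat -> fxmod A) = 0).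
  rewrite -(revp_lincomb _ AB) //; split=> [->|/inj //]; exact: scaler0.
split=> [/ker h i ik|h].
  by apply/(dvdp_revp (d0 i ik) (sp i ik))/h.
by apply/ker => i ik; apply/(dvdp_revp (d0 i ik) (sp i ik))/h.
Qed.
End Reciprocal.

(** * Class types: conjugacy classes of GL_n as tuples of polynomials *)

Section Factors.
Variables (F : fieldType) (n : nat).
Implicit Types (u : 'I_n -> {poly F}) (i : nat) (d : nat -> {poly F}).

(** The invariant factors d_0, d_1, ... of a chain are arbitrary partial
    products of factors u_j = d_j / d_(j+1), which carry no divisibility
    condition. The entry u_j divides j+1 of the d_i, which is why a class
    weighs sum (j+1) deg u_j. *)
Definition inv_factor u i : {poly F} := \prod_(j < n | (i <= j)%N) u j.

Lemma inv_factor_recl u (i : 'I_n) : inv_factor u i = u i * inv_factor u i.+1.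
Proof.
rewrite /inv_factor (bigD1 i) //=; congr (_ * _); apply: eq_bigl => j.
by rewrite ltn_neqAle andbC eq_sym.
Qed.

Lemma inv_factor_n u : inv_factor u n = 1.
Proof. by rewrite /inv_factor big1 // => j; rewrite leqNgt ltn_ord. Qed.

Lemma inv_factor_chain k u : chain k (inv_factor u).
Proof.
move=> i j /andP[ij _]; rewrite /inv_factor [X in _ %| X](bigID (fun l : 'I_n => (j <= l)%N)) /=.
rewrite dvdp_mulr // (eq_bigl (fun l : 'I_n => (i <= l)%N && (j <= l)%N)) // => l.
by rewrite andbC; case: leqP => // /(leq_trans ij)->.
Qed.

Lemma inv_factor_coef0 u i : (forall j, (u j)`_0 = 1) -> (inv_factor u i)`_0 = 1.
Proof.
move=> u1; rewrite /inv_factor; elim/big_ind: _ => [|p q p1 q1|j _] //; first by rewrite coef1.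
by rewrite coef0M p1 q1 mulr1.
Qed.

Lemma size_prod1 (I : finType) (P : pred I) (u : I -> {poly F}) :
  (forall j, u j != 0) ->
  (size (\prod_(j | P j) u j)).-1 = (\sum_(j | P j) (size (u j)).-1)%N.
Proof.
move=> u0; suff [] : \prod_(j | P j) u j != 0 /\
    (size (\prod_(j | P j) u j)).-1 = (\sum_(j | P j) (size (u j)).-1)%N by [].
apply: (big_ind2 (fun (p : {poly F}) m => p != 0 /\ (size p).-1 = m)) => //.
  by rewrite oner_neq0 size_poly1.
move=> p l q m [p0 <-] [q0 <-]; rewrite mulf_neq0 // size_mul //; split=> //.
move: p0 q0; rewrite -!size_poly_gt0; case: (size p) => // a; case: (size q) => // b _ _.
by rewrite addSn addnS.
Qed.

Lemma sum_size_inv_factor u : (forall j, u j != 0) ->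
  (\sum_(i < n) (size (inv_factor u i)).-1 = \sum_(j < n) j.+1 * (size (u j)).-1)%N.
Proof.
move=> u0; rewrite (eq_bigr (fun i : 'I_n => \sum_(j < n | i <= j) (size (u j)).-1)%N); last first.
  by move=> i _; rewrite size_prod1.
rewrite (exchange_big_dep xpredT) //=; apply: eq_bigr => j _.
rewrite sum_nat_const; congr (_ * _)%N.
rewrite -sum1_card -(big_ord_widen n (fun=> 1%N) (ltn_ord j)).
by rewrite sum_nat_const card_ord muln1.
Qed.

Lemma inv_factor_inj u1 u2 : (forall j, (u1 j)`_0 = 1) -> (forall j, (u2 j)`_0 = 1) ->
  (forall i, (i < n)%N -> inv_factor u1 i = inv_factor u2 i) -> forall j, u1 j = u2 j.
Proof.
move=> h1 h2 e j; apply: (mulIf (coef0_neq0 (inv_factor_coef0 j.+1 h1))).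
rewrite -inv_factor_recl e // inv_factor_recl; congr (_ * _).
have := ltn_ord j; rewrite leq_eqVlt => /orP[/eqP->|/e->//].
by rewrite !inv_factor_n.
Qed.

Lemma inv_factor_surj d : chain n d -> (forall i, (i < n)%N -> (d i)`_0 = 1) ->
  exists u : 'I_n -> {poly F}, (forall j, (u j)`_0 = 1) /\
    forall i, (i < n)%N -> inv_factor u i = d i.
Proof.
move=> chd d1; pose d' := update n d 1.
have dd' i : (i < n)%N -> d i = d' i by move=> h; rewrite /d' /update ltn_eqF.
have d'1 i : (i <= n)%N -> (d' i)`_0 = 1.
  by rewrite leq_eqVlt /d' /update => /orP[->|h]; rewrite ?coef1 // ltn_eqF // d1.
have dvd i : (i < n)%N -> d' i.+1 %| d' i.
  move=> h; have := h; rewrite leq_eqVlt => /orP[/eqP->|h']; first by rewrite /d' update_same dvd1p.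
  by rewrite -!dd' //; apply: chd; rewrite leqnSn.
pose u (j : 'I_n) := d' j %/ d' j.+1; exists u.
have uE (j : 'I_n) : u j * d' j.+1 = d' j by rewrite divpK // dvd.
split=> [j|i ik].
  have := congr1 (fun p : {poly F} => p`_0) (uE j).
  by rewrite coef0M !d'1 ?mulr1 // ltnW.
rewrite dd' //.
have: (i <= n)%N by apply: ltnW.
move=> {ik} h; rewrite -(subKn h); elim: (n - i)%N (leq_subr i n) => [|l IH] ln.
  by rewrite subn0 inv_factor_n /d' update_same.
have h' : (n - l.+1 < n)%N by lia.
rewrite -[(n - l.+1)%N]/(nat_of_ord (Ordinal h')) inv_factor_recl -uE; congr (_ * _).
by rewrite -[in LHS]/(n - l.+1).+1 /= -subSn // subSS IH // ltnW.
Qed.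

Lemma inv_factor_recip lam u i : lam != 0 -> (forall j, u j != 0) ->
  recip lam (inv_factor u i) = inv_factor (fun j => recip lam (u j)) i.
Proof.
move=> l0 u0; suff [] : inv_factor u i != 0 /\
  recip lam (inv_factor u i) = inv_factor (fun j => recip lam (u j)) i by [].
apply: (big_ind2 (fun p q => p != 0 /\ recip lam p = q)) => //.
  by rewrite oner_neq0 recip1.
by move=> p p' q q' [p0 <-] [q0 <-]; rewrite mulf_neq0 // recipM.
Qed.

End Factors.

Section Types.
Variables (F : finFieldType) (n' : nat).
Notation n := n'.+1.
Notation ctype := {ffun 'I_n -> {poly_n.+1 F}}.
Implicit Types (u : ctype) (A B X : 'M[F]_n).

Definition type_factor u := inv_factor (fun j => polyn (u j)).

(** The names of the conjugacy classes of GL_n. The exponent n_(j+1) of the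
    partition attached to u is the degree of u_j. *)
Definition ctypes : {set ctype} :=
  [set u : ctype | [forall j, (u j : {poly F})`_0 == 1] &&
     (\sum_(j < n) j.+1 * (size (u j : {poly F})).-1 == n)%N].

Definition has_type A u := exists v : nat -> fxmod A, decomposes n (type_factor u) v.

Lemma ctype_coef0 u : u \in ctypes -> forall j, (u j : {poly F})`_0 = 1.
Proof. by rewrite inE => /andP[/forallP h _] j; apply/eqP. Qed.

Lemma ctype_neq0 u : u \in ctypes -> forall j, (u j : {poly F}) != 0.
Proof. by move=> uU j; apply/coef0_neq0/ctype_coef0. Qed.

Lemma type_factor_coef0 u i : u \in ctypes -> (type_factor u i)`_0 = 1.
Proof. by move=> uU; apply/inv_factor_coef0/ctype_coef0. Qed.

(** The invariant factors divide the characteristic polynomial, whose constant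
    term is nonzero because A is invertible; hence they can be normalised to
    have constant term 1. *)
Lemma has_type_exists A : A \in unitmx -> exists2 u, u \in ctypes & has_type A u.
Proof.
move=> uA; have [d [v [dv chd d0]]] := decomposition_exists A.
have char0 : (char_poly A)`_0 != 0.
  by rewrite char_poly_det mulf_neq0 ?expf_neq0 ?oppr_eq0 ?oner_eq0 // -unitfE.
have d00 i : (i < n)%N -> (d i)`_0 != 0.
  move=> ik; have /dvdpP[q e] := dvd_annihilator dv (@fxmod_torsion _ _ A) ik.
  by apply: contra char0 => /eqP h; rewrite e coef0M h mulr0.
pose e i := ((d i)`_0)^-1 *: d i.
have e1 i : (i < n)%N -> (e i)`_0 = 1 by move=> ik; rewrite coefZ mulVf ?d00.
have eqe i q : (i < n)%N -> (e i %| q) = (d i %| q).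
  by move=> ik; rewrite dvdpZl // invr_eq0 d00.
have ev : decomposes n e v.
  case: dv => gen ker; split=> // p; split=> [/ker h i ik|h].
    by rewrite eqe // h.
  by apply/ker => i ik; rewrite -eqe // h.
have che : chain n e.
  move=> i j /andP[ij jn]; rewrite eqe // dvdpZr ?invr_eq0 ?d00 ?(leq_ltn_trans ij) //.
  by apply: chd; rewrite ij.
have [u [u1 ue]] := inv_factor_surj che e1.
have u0 j : u j != 0 := coef0_neq0 (u1 j).
have sumn : (\sum_(j < n) j.+1 * (size (u j)).-1 = n)%N.
  rewrite -sum_size_inv_factor // [RHS](decomposes_degree ev) => [|i ik]; last exact/coef0_neq0/e1.
  by apply: eq_bigr => i _; rewrite ue.
have su j : (size (u j) <= n.+1)%N.
  rewrite -ltnS -[size _]prednK ?size_poly_gt0 // !ltnS -[X in (_ <= X)%N]sumn.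
  by rewrite (bigD1 j) //= mulSn -addnA leq_addr.
pose w : ctype := [ffun j => npolyp n.+1 (u j)].
have wE j : (w j : {poly F}) = u j by rewrite ffunE npolypK.
exists w.
  rewrite inE; apply/andP; split; first by apply/forallP => j; rewrite wE u1.
  by under eq_bigr => j _ do rewrite wE; rewrite sumn.
exists v.
have eqw i : (i < n)%N -> type_factor w i = e i.
  by move=> ik; rewrite -ue //; apply: eq_bigr => j _; rewrite wE.
case: ev => gen ker; split=> // p; split=> [/ker h i ik|h].
  by rewrite eqw // h.
by apply/ker => i ik; rewrite -eqw // h.
Qed.

Lemma has_type_unique A u1 u2 : u1 \in ctypes -> u2 \in ctypes ->
  has_type A u1 -> has_type A u2 -> u1 = u2.
Proof.
move=> U1 U2 [v1 h1] [v2 h2]; apply/ffunP => j; apply/val_inj.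
apply: (inv_factor_inj (ctype_coef0 U1) (ctype_coef0 U2)) => i ik.
apply: (invariant_factors_unique (V := fxmod A) _ _ _ _ h1 h2 ik);
  first [exact: inv_factor_chain | by move=> l _; exact: type_factor_coef0].
Qed.

Lemma has_type_similar A B X u : X \in unitmx -> A *m X = X *m B ->
  has_type A u -> has_type B u.
Proof. by move=> uX e [v dv]; exists (fun i => v i *m X); apply: similar_decomposes dv. Qed.

Lemma similar_has_type A B u : has_type A u -> has_type B u ->
  exists2 X, X \in unitmx & A *m X = X *m B.
Proof. by move=> [v dv] [w dw]; have [X [uX e _]] := decomposes_similar dv dw; exists X. Qed.

(** Invertibility: the factors are prime to t, so t acts injectively. *)
Lemma has_type_realised u : u \in ctypes ->
  exists2 A, A \in unitmx & has_type A u.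
Proof.
move=> uU.
have sn : n = (\sum_(i < n) (size (type_factor u i)).-1)%N.
  by move: (uU); rewrite sum_size_inv_factor ?inE; [case/andP=> _ /eqP-> | exact: ctype_neq0].
have [|A [v dv]] := realisation _ sn.
  by move=> i _; apply/coef0_neq0/type_factor_coef0.
exists A; last by exists v.
rewrite -row_free_unit; apply: inj_row_free => x xA.
have [gen ker] := dv; have [p ep] := gen x; rewrite ep; apply/ker => i ik.
have /ker/(_ i ik) : lincomb n (fun i => 'X * p i) v = 0 by rewrite lincombZ -ep fxmodX.
rewrite Gauss_dvdpr // -['X]subr0 -[0]/(0%:P) coprimep_XsubC.
by rewrite /root horner_coef0 type_factor_coef0 ?oner_neq0.
Qed.

Definition ctype_recip lam u : ctype := [ffun j => npolyp n.+1 (recip lam (u j))].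

Lemma ctype_recipE lam u j : u \in ctypes -> lam != 0 ->
  ctype_recip lam u j = recip lam (u j) :> {poly F}.
Proof.
move=> uU l0; rewrite ffunE npolypK // size_recip // ?size_npoly //.
by rewrite ctype_coef0 // oner_neq0.
Qed.

Lemma ctype_recip_in lam u : lam != 0 -> u \in ctypes -> ctype_recip lam u \in ctypes.
Proof.
move=> l0 uU; rewrite inE; apply/andP; split.
  by apply/forallP => j; rewrite ctype_recipE // recip_coef0 // ctype_neq0.
move: (uU); rewrite inE => /andP[_ /eqP e]; rewrite -[X in _ == X]e.
apply/eqP/eq_bigr => j _; rewrite ctype_recipE // size_recip //.
by rewrite ctype_coef0 // oner_neq0.
Qed.

Lemma type_factor_recip lam u i : lam != 0 -> u \in ctypes ->
  type_factor (ctype_recip lam u) i = recip lam (type_factor u i).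
Proof.
move=> l0 uU; rewrite /type_factor inv_factor_recip //; last exact: ctype_neq0.
by apply: eq_bigr => j _; rewrite ctype_recipE.
Qed.

Lemma recip_decomposes_type lam A B u (v : nat -> 'rV[F]_n) :
  lam != 0 -> A *m B = lam%:M -> u \in ctypes ->
  decomposes n (type_factor u) (v : nat -> fxmod A) ->
  decomposes n (type_factor (ctype_recip lam u)) (v : nat -> fxmod B).
Proof.
move=> l0 AB uU dv.
have h i : (i < n)%N -> (type_factor u i)`_0 != 0 by rewrite type_factor_coef0 ?oner_neq0.
have [gen ker] := recip_decomposes l0 AB h dv; split=> // p.
split=> [/ker h' i ik|h']; first by rewrite type_factor_recip ?h'.
by apply/ker => i ik; rewrite -type_factor_recip ?h'.
Qed.

Lemma has_type_recip lam A B u : lam != 0 -> A *m B = lam%:M -> u \in ctypes ->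
  has_type A u -> has_type B (ctype_recip lam u).
Proof. by move=> l0 AB uU [v dv]; exists v; apply: recip_decomposes_type dv. Qed.

(** Both A and B = lam A^-1 are decomposed by the same generators v_i with the
    same invariant factors: those of B are the twisted reciprocals of those of
    A, and uniqueness makes them equal as A and B are similar. The isomorphism
    Y that fixes every v_i intertwines A and B. Since B = lam A^-1, the square
    of Y commutes with A; it fixes the generators, so it is the identity. *)
Lemma similar_involution lam A B X : lam != 0 -> A *m B = lam%:M ->
  X \in unitmx -> A *m X = X *m B ->
  exists2 Y, Y *m Y = 1%:M & A *m Y = Y *m B.
Proof.
move=> l0 AB uX e; have uA := mulmx_scalar_unit l0 AB.
have [u uU [v dv]] := has_type_exists uA.
have tB : has_type B u by apply: has_type_similar e _ => //; exists v.
have dvB := recip_decomposes_type l0 AB uU dv.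
have eu : ctype_recip lam u = u.
  by apply: (has_type_unique (A := B)) => //; [exact: ctype_recip_in | exists v].
rewrite eu in dvB; have [Y [uY eY vY]] := decomposes_similar dv dvB.
exists Y => //.
have YY : A *m (Y *m Y) = (Y *m Y) *m A.
  rewrite mulmxA eY -!mulmxA; congr (Y *m _).
  apply: (can_inj (mulKmx uA)).
  rewrite !mulmxA AB eY -mulmxA (mulmx_scalarC l0 AB).
  by rewrite mul_scalar_mx mul_mx_scalar.
apply/row_matrixP => i; rewrite !rowE mulmx1.
case: dv => gen _; have [p ->] := gen (delta_mx 0 i).
rewrite (mulmx_lincomb _ p v YY) /lincomb; apply: eq_bigr => j _.
by rewrite mulmxA !vY ?ltn_ord.
Qed.

End Types.

(** * Counting classes fixed by an equivariant map *)

Section Classes.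
Local Open Scope group_scope.
Variable gT : finGroupType.
Implicit Types (G H Z : {group gT}) (phi : gT -> gT) (C : {set gT}).

(** For equivariant phi the choice of representative is immaterial. *)
Definition fixes_class phi C : bool := phi (repr C) \in C.

Definition equivariant G phi :=
  {in G, forall x, phi x \in G} /\ {in G &, forall x y, phi (x ^ y) = phi x ^ y}.

Lemma fixes_classE G phi C x : equivariant G phi -> C \in classes G -> x \in C ->
  fixes_class phi C = (phi x \in C).
Proof.
move=> [pG pJ] /imsetP[y Gy ->] /imsetP[z Gz ->]; rewrite /fixes_class.
have hJ t w : t \in G -> (w ^ t \in y ^: G) = (w \in y ^: G).
  by move=> Gt; rewrite memJ_norm // (subsetP (class_norm y G)).
by case: (repr_class G y) => t Gt ->; rewrite !pJ // !hJ.
Qed.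

(** The elements conjugating x to z form a right coset of the centraliser of
    x. *)
Lemma card_conjugators G x z : z \in x ^: G ->
  #|[set y in G | x ^ y == z]| = #|'C_G[x]|.
Proof.
move=> /imsetP[y0 Gy0 ->]; rewrite -(card_rcoset 'C_G[x] y0); apply: eq_card => y.
rewrite inE mem_rcoset inE groupMr ?groupV // cent1C; congr (_ && _).
apply/eqP/cent1P => [e|].
  by apply/commgP/conjg_fixP; rewrite conjgM e conjgK.
by move/commgP/conjg_fixP; rewrite conjgM => /(canRL (conjgKV _)).
Qed.

(** An element x of a class C fixed by phi is taken to phi x by as many y as
    its centraliser has elements, so C contributes #|C| times #|G| / #|C|; the
    other classes contribute nothing. *)
Lemma card_fixed_classes G phi : equivariant G phi ->
  (\sum_(x in G) \sum_(y in G) ((x ^ y)%g == phi x) =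
   #|[set C in classes G | fixes_class phi C]| * #|G|)%N.
Proof.
move=> eqv; rewrite (set_partition_big _ (classes_partition G)) /=.
rewrite -sum1_card big_distrl /= big_mkcond [RHS]big_mkcond; apply: eq_bigr => C _.
rewrite inE; case: ifP => //= CG; have [x Gx eC] := imsetP CG.
have cx y : y \in C -> y \in G /\ y ^: G = C.
  rewrite eC => xy; split; last by apply/class_eqP.
  by apply: (subsetP (class_subG Gx (subxx G))).
case: ifP => fx; last first.
  apply: big1 => y Cy; have [Gy ey] := cx y Cy; apply: big1 => z Gz.
  apply/eqP; rewrite eqb0; apply/eqP => e; move: fx.
  by rewrite (fixes_classE eqv CG Cy) -e -ey memJ_class.
rewrite mul1n; transitivity (\sum_(y in C) #|'C_G[x]|)%N.
  apply: eq_bigr => y Cy; have [Gy ey] := cx y Cy.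
  have fy : phi y \in y ^: G by rewrite ey -(fixes_classE eqv CG Cy).
  rewrite -big_mkcondr sum1_card -cardsE.
  have := card_conjugators fy.
  have -> : #|'C_G[y]| = #|'C_G[x]|.
    apply/eqP; rewrite -(eqn_pmul2r (indexg_gt0 G 'C_G[x])) Lagrange ?subsetIl //.
    by rewrite index_cent1 -eC -ey -index_cent1 Lagrange ?subsetIl.
  by move=> <-; apply: eq_card => z; rewrite !inE.
by rewrite sum_nat_const eC -index_cent1 mulnC Lagrange // subsetIl.
Qed.

Lemma sum_coset G H (f : coset_of H -> nat) : H <| G ->
  (\sum_(x in G) f (coset H x) = #|H| * \sum_(X in G / H) f X)%N.
Proof.
move=> nHG; rewrite (partition_big (coset H) (mem (G / H))) /=; last first.
  by move=> x Gx; apply: mem_quotient.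
rewrite big_distrr; apply: eq_bigr => X /morphimP[x [Nx Gx ->]].
rewrite (eq_bigr (fun=> f (coset H x))) => [|y /andP[_ /eqP->]] //.
rewrite sum_nat_const; congr (_ * _)%N; rewrite -(card_rcoset H x).
apply: eq_card => y; rewrite unfold_in /=.
apply/andP/idP => [[Gy /eqP e]|].
  apply/rcosetP; exists (y * x^-1); last by rewrite mulgKV.
  apply: coset_idr; first by rewrite groupM ?groupV // (subsetP (normal_norm nHG)).
  rewrite morphM ?groupV ?(subsetP (normal_norm nHG)) ?groupV //=.
  by rewrite morphV ?(subsetP (normal_norm nHG)) //= e mulgV.
case/rcosetP => h Hh ->; rewrite coset_kerl //; split=> //.
by rewrite groupM ?(subsetP (normal_sub nHG) h).
Qed.

Lemma equivariant_twist G z : z \in 'Z(G) -> equivariant G (fun x => z * x^-1).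
Proof.
case/centerP=> Gz cz; split=> [x Gx|x y Gx Gy]; first by rewrite groupM ?groupV.
rewrite conjMg conjVg; congr (_ * _).
by apply/esym/conjg_fixP/commgP/cz.
Qed.

Lemma real_eltE G x : real_elt G x = (x^-1 \in x ^: G).
Proof.
apply/exists_inP/imsetP => [[y Gy /eqP e]|[y Gy e]].
  by exists y^-1; rewrite ?groupV // conjgE invgK -e mulgA.
by exists y^-1; rewrite ?groupV // e conjgE invgK mulgA.
Qed.

(** The factor 1 puts inversion in the form z x^-1 of the twisted maps. *)
Lemma real_classE G C : C \in classes G ->
  real_class G C = fixes_class (fun x => 1 * x^-1) C.
Proof.
move=> CG; have eqv := equivariant_twist (group1 'Z(G)).
have h x : x \in C -> real_elt G x = fixes_class (fun x => 1 * x^-1) C.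
  move=> Cx; rewrite (fixes_classE eqv CG Cx) mul1g real_eltE.
  have [y Gy eC] := imsetP CG; rewrite eC in Cx *.
  by rewrite (class_eqP Cx).
apply/forall_inP/idP => [H|f x Cx]; last by rewrite h.
by rewrite -(h (repr C)) ?H // (mem_repr_classes CG).
Qed.

End Classes.

Section CentralQuotient.
Local Open Scope group_scope.
Variable gT : finGroupType.
Implicit Types (G Z : {group gT}).

(** Count the pairs (x, y) of elements of G whose images satisfy x ^ y = x^-1
    in two ways. Each pair of cosets is hit by #|Z|^2 pairs, and for each such
    (x, y) exactly one z in Z has x ^ y = z x^-1. *)
Lemma central_quotient_real_classes G Z : Z \subset 'Z(G) ->
  (#|Z| * #|[set C in classes (G / Z) | real_class (G / Z) C]| =
   \sum_(z in Z) #|[set C in classes G | fixes_class (fun x => z * x^-1)%g C]|)%N.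
Proof.
move=> sZ; have nZG : Z <| G := sub_center_normal sZ.
have NG x : x \in G -> x \in 'N(Z) := subsetP (normal_norm nZG) x.
pose f (X Y : coset_of Z) : nat := (X ^ Y)%g == 1 * X^-1.
have e1 : (\sum_(x in G) \sum_(y in G) f (coset Z x) (coset Z y) =
    #|Z| * #|Z| * #|[set C in classes (G / Z) | real_class (G / Z) C]| * #|(G / Z)%g|)%N.
  under eq_bigr => x _ do rewrite (sum_coset (fun Y => f (coset Z x) Y) nZG).
  rewrite -big_distrr (sum_coset (fun X => \sum_(Y in G / Z) f X Y)%N nZG) /=.
  rewrite (card_fixed_classes (equivariant_twist (group1 'Z(G / Z)))) !mulnA.
  congr (_ * _ * _)%N; apply: eq_card => C; rewrite !inE.
  by case: (boolP (C \in _)) => //= CG; rewrite real_classE.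
have e2 : (\sum_(x in G) \sum_(y in G) f (coset Z x) (coset Z y) =
    (\sum_(z in Z) #|[set C in classes G | fixes_class (fun x => z * x^-1)%g C]|) * #|G|)%N.
  transitivity (\sum_(z in Z) \sum_(x in G) \sum_(y in G) ((x ^ y)%g == (z * x^-1)%g))%N.
    rewrite [RHS]exchange_big; apply: eq_bigr => x Gx; rewrite [RHS]exchange_big.
    apply: eq_bigr => y Gy; rewrite /f mul1g -morphJ ?NG // -morphV ?NG //=.
    transitivity ((x ^ y * x)%g \in Z : nat).
      congr (nat_of_bool _); apply/eqP/idP => [e|h].
        apply: coset_idr; first by rewrite NG // groupM ?groupJ.
        by rewrite morphM ?NG ?groupJ //= e morphV ?NG //= mulVg.
      by rewrite -(coset_kerl (x^-1) h) mulgK.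
    rewrite (eq_bigr (fun z => (z == x ^ y * x)%g : nat)) => [|z _].
      case: (boolP (_ \in Z)) => h.
        rewrite (bigD1 (x ^ y * x)) //= eqxx big1 // => z /andP[_ /negPf->] //.
      by rewrite big1 // => z Zz; rewrite (negPf (memPn h z Zz)).
    by congr (nat_of_bool _); rewrite eq_sym -(inj_eq (mulIg x)) mulgKV.
  rewrite big_distrl; apply: eq_bigr => z Zz.
  by rewrite (card_fixed_classes (equivariant_twist (subsetP sZ z Zz))).
move: e2; rewrite e1 -(Lagrange (normal_sub nZG)) -card_quotient ?normal_norm //.
move/eqP; rewrite mulnA eqn_pmul2r ?cardG_gt0 // -mulnA mulnC eqn_pmul2r ?cardG_gt0 //.
by move/eqP.
Qed.
End CentralQuotient.

(** * Counting polynomials equal to their twisted reciprocal *)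

Section RecipRoots.

Lemma recipZ (F : fieldType) (lam c : F) (p : {poly F}) : c != 0 ->
  recip lam (c *: p) = recip lam p.
Proof.
move=> c0; rewrite /recip size_scale // lead_coefZ revpZ scalerA; congr (_ *: _).
by rewrite -mulrA invfM mulrAC mulVf // mul1r.
Qed.

Lemma map_recip (F K : fieldType) (f : {rmorphism F -> K}) lam p :
  map_poly f (recip lam p) = recip (f lam) (map_poly f p).
Proof.
apply/polyP => j; rewrite coef_map !coef_recip size_map_poly lead_coef_map.
rewrite !coef_map; case: ifP => _ /=; last by rewrite rmorph0.
by rewrite rmorphM fmorphV !rmorphM !rmorphXn.
Qed.

Lemma recip_XsubC (K : fieldType) (z : K) : z != 0 ->
  recip 1 ('X - z%:P) %= 'X - z^-1%:P.
Proof.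
move=> z0; rewrite (eqp_ltrans (recip_eqp (oner_neq0 _) _)) ?polyXsubC_eq0 //.
suff -> : revp 1 (size ('X - z%:P)).-1 ('X - z%:P) = - z *: ('X - z^-1%:P).
  by rewrite eqp_scale // oppr_eq0.
rewrite size_XsubC; apply/polyP => -[|[|j]];
  rewrite coef_revp coefZ !coefB !coefX !coefC /= ?expr1n ?mulr1.
- by rewrite !subr0 sub0r mulrNN divff.
- by rewrite subr0 mulr1 sub0r.
- by rewrite subr0 mulr0.
Qed.

Lemma recip_prod_XsubC (K : fieldType) (s : seq K) : 0 \notin s ->
  recip 1 (\prod_(z <- s) ('X - z%:P)) %= \prod_(z <- [seq z^-1 | z <- s]) ('X - z%:P).
Proof.
elim: s => [_|z s IH]; first by rewrite /= !big_nil recip1 ?oner_neq0 ?eqpxx.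
rewrite inE negb_or eq_sym => /andP[z0 s0].
rewrite /= !big_cons recipM ?oner_neq0 ?polyXsubC_eq0 //.
  by rewrite (eqp_trans (eqp_mull _ (IH s0))) // eqp_mulr // recip_XsubC.
by rewrite monic_neq0 ?monic_prod_XsubC.
Qed.

Variable F : finFieldType.

(** Over the algebraic closure f is a scalar multiple of the product of the X
    - z and its reciprocal one of the product of the X - 1/z; monic split
    polynomials are equal exactly when their roots agree with multiplicity,
    and the common constant term 1 determines the scalar. *)
Lemma self_reciprocalE (f : {poly F}) : f`_0 = 1 ->
  self_reciprocal f = (recip 1 f == f).
Proof.
move=> f1; have f0 := coef0_neq0 f1.
rewrite /self_reciprocal /closure_roots; case: closed_field_poly_normal => s /= fE.
set g := map_poly _ f in fE; set P := \prod_(z <- s) _ in fE.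
have g0 : g != 0 by rewrite map_poly_eq0.
have lg0 : lead_coef g != 0 by rewrite lead_coef_eq0.
have s0 : 0 \notin s.
  apply/negP => s0; have : root g 0 by rewrite fE rootZ // root_prod_XsubC.
  by rewrite /root horner_coef0 coef_map f1 /= rmorph1 oner_eq0.
have gr : recip 1 g %= \prod_(z <- [seq z^-1 | z <- s]) ('X - z%:P).
  by rewrite fE recipZ //; apply: recip_prod_XsubC.
have gP : g %= P by rewrite fE eqp_scale.
have -> : (recip 1 f == f) = (recip 1 g == g).
  by rewrite -(inj_eq (map_poly_inj (to_alg_closure F))) map_recip /= rmorph1.
apply/idP/eqP => [sp|e].
  have {}gr : recip 1 g %= g.
    rewrite (eqp_trans gr) // eqp_sym (eqp_trans gP) //.
    by rewrite /P (perm_big _ sp) eqpxx.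
  have /andP[h1 h2] := gr; apply: dvdp_const1 => //.
    by rewrite recip_coef0 ?oner_neq0.
  by rewrite coef_map f1 /= rmorph1.
apply: prod_XsubC_eq; apply/eqP; rewrite -eqp_monic ?monic_prod_XsubC //.
by rewrite -(eqp_rtrans gr) e eqp_sym.
Qed.

(** The ambient bound m is a parameter because the entries of class types all
    live in the type of polynomials of degree at most n. *)
Definition recip_fixed m lam d : {set {poly_m F}} :=
  [set f : {poly_m F} | [&& size (f : {poly F}) == d.+1,
     (f : {poly F})`_0 == 1 & recip lam f == f]].

Definition num_recip_fixed lam d := #|recip_fixed d.+1 lam d|.

Lemma num_self_reciprocalE d : num_self_reciprocal F d = num_recip_fixed 1 d.
Proof.
apply: eq_card => f; rewrite !inE -horner_coef0; case: (_ == d.+1) => //=.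
case: eqP => //= f1; apply: self_reciprocalE; by rewrite -horner_coef0.
Qed.

Lemma card_recip_fixed m lam d : (d < m)%N -> #|recip_fixed m lam d| = num_recip_fixed lam d.
Proof.
move=> dm; pose h (f : {poly_d.+1 F}) : {poly_m F} := npolyp m f.
have hE f : h f = f :> {poly F}.
  by rewrite npolypK // (leq_trans (size_npoly f)).
rewrite /num_recip_fixed -(card_imset (f := h)) => [|f1 f2 e]; last first.
  by apply/val_inj; rewrite /= -hE e hE.
apply: eq_card => f; apply/idP/imsetP => [|[g gS ->]]; last by move: gS; rewrite !inE hE.
rewrite inE => /and3P[/eqP s1 s2 s3]; exists (npolyp d.+1 f); last first.
  by apply/val_inj; rewrite /= hE npolypK ?s1.
by rewrite inE npolypK ?s1 // eqxx s2.
Qed.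

Lemma recip_fixP lam d (f : {poly F}) : lam != 0 -> size f = d.+1 ->
  (recip lam f == f) <-> (forall j, (j <= d)%N -> f`_j * f`_d * lam ^+ j = f`_(d - j)).
Proof.
move=> l0 sf.
have fd : f`_d != 0 by rewrite -[d]/(d.+1.-1) -sf -lead_coefE lead_coef_eq0 -size_poly_eq0 sf.
have -> : (recip lam f == f) <-> (forall j, (j <= d)%N ->
    f`_(d - j) * lam ^+ (d - j) / (f`_d * lam ^+ d) = f`_j).
  split=> [/eqP e j jd|h].
    by rewrite -{3}e coef_recip sf jd lead_coefE sf.
  apply/eqP/polyP => j; rewrite coef_recip sf lead_coefE sf /=.
  by case: leqP => jd; [exact: h | rewrite nth_default ?sf].
have nz j : (j <= d)%N -> (f`_(d - j) * lam ^+ (d - j) / (f`_d * lam ^+ d) = f`_j) <->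
    f`_j * f`_d * lam ^+ j = f`_(d - j).
  move=> jd; have -> : lam ^+ d = lam ^+ (d - j) * lam ^+ j by rewrite -exprD subnK.
  split=> [<-|<-]; by field; rewrite fd !expf_neq0.
by split=> h j jd; apply/nz => //; apply: h.
Qed.

(** Multiplying the j-th coefficient by w j transports the equations of
    recip_fixP from multiplier 1 to lam when w satisfies the stated
    identity. *)
Lemma num_recip_fixed_weights lam d (w : nat -> F) : lam != 0 -> w 0%N = 1 ->
  (forall j, (j <= d)%N -> w j != 0) ->
  (forall j, (j <= d)%N -> w j * w d * lam ^+ j = w (d - j)%N) ->
  num_recip_fixed lam d = num_recip_fixed 1 d.
Proof.
move=> l0 w0 wn0 wE.
pose h (c : nat -> F) (f : {poly_d.+1 F}) : {poly_d.+1 F} :=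
  npolyp d.+1 (\poly_(j < d.+1) (c j * f`_j)).
have hE c f j : (j <= d)%N -> (h c f)`_j = c j * f`_j.
  by move=> jd; rewrite coef_npolyp ltnS jd coef_poly ltnS jd.
have hK : cancel (h w) (h (fun j => (w j)^-1)).
  move=> f; apply/npolyP => j; have [jd|jd] := leqP j d.
    by rewrite !hE // mulKf // wn0.
  by rewrite !big_coef_npoly.
have hK' : cancel (h (fun j => (w j)^-1)) (h w).
  move=> f; apply/npolyP => j; have [jd|jd] := leqP j d.
    by rewrite !hE // mulVKf // wn0.
  by rewrite !big_coef_npoly.
have bh : {on [pred f in recip_fixed d.+1 lam d], bijective (h w)}.
  by apply: onW_bij; exists (h (fun j => (w j)^-1)).
rewrite /num_recip_fixed -[LHS](on_card_preimset bh); apply: eq_card => f.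
rewrite !inE hE // w0 mul1r.
have sE (g : {poly_d.+1 F}) : (size g == d.+1) = (g`_d != 0).
  apply/eqP/idP => [e|gd].
    have -> : g`_d = lead_coef g by rewrite lead_coefE e.
    by rewrite lead_coef_eq0 -size_poly_eq0 e.
  apply/eqP; rewrite eqn_leq size_npoly ltnNge; apply: contra gd => gd.
  by rewrite nth_default.
have -> : (size (h w f) == d.+1) = (size f == d.+1).
  by rewrite !sE hE // mulf_eq0 (negPf (wn0 d _)).
case: eqP => //= sf; case: eqP => //= f1.
have sh : size (h w f) = d.+1.
  by apply/eqP; rewrite sE hE // mulf_neq0 ?wn0 // -sE; apply/eqP.
have o0 : 1 != 0 :> F := oner_neq0 _.
apply/idP/idP => [/(recip_fixP l0 sh) H|/(recip_fixP o0 sf) H].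
  apply/(recip_fixP o0 sf) => j jd; have := H j jd.
  rewrite !hE ?leq_subr // -wE // expr1n mulr1 => e.
  apply: (mulfI (mulf_neq0 (mulf_neq0 (wn0 j jd) (wn0 d (leqnn d))) (expf_neq0 j l0))).
  by rewrite -e; ring.
apply/(recip_fixP l0 sh) => j jd; have := H j jd.
by rewrite !hE ?leq_subr // -wE // expr1n mulr1 => <-; ring.
Qed.

(** For d = 2k, leave the lower half of the coefficients alone and divide the
    coefficient of index k + i by lam^i; the weight uses truncated subtraction
    for this. *)
Lemma num_recip_fixed_even lam d : lam != 0 -> ~~ odd d ->
  num_recip_fixed lam d = num_recip_fixed 1 d.
Proof.
move=> l0 ed; have dE : d = (d./2 + d./2)%N by rewrite addnn even_halfK.
apply: (num_recip_fixed_weights (w := fun j => lam^-1 ^+ (j - d./2))) => // [j _|j jd].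
  by rewrite expf_neq0 // invr_eq0.
have [jk|kj] := leqP j d./2.
  have -> : (j - d./2 = 0)%N by lia.
  have -> : (d - d./2 = (d - j - d./2) + j)%N by lia.
  by rewrite mul1r exprD -mulrA -exprMn mulVf // expr1n mulr1.
have -> : (d - j - d./2 = 0)%N by lia.
have -> : (j = (j - d./2) + d./2)%N by lia.
rewrite addnK (_ : (d - d./2 = d./2)%N); last by lia.
by rewrite exprD mulrACA -!exprMn mulVf // !expr1n mulr1.
Qed.

(** For lam = mu^2, substitute t / mu for t. *)
Lemma num_recip_fixed_square mu d : mu != 0 -> num_recip_fixed (mu ^+ 2) d = num_recip_fixed 1 d.
Proof.
move=> m0; apply: (num_recip_fixed_weights (w := fun j => mu^-1 ^+ j)) => [||j _|j jd];
  rewrite ?expf_neq0 ?invr_eq0 //.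
have e : mu ^+ 2 ^+ j * (mu^-1 ^+ j * mu^-1 ^+ j) = 1.
  by rewrite expr2 exprMn mulrACA -!exprMn mulfV // mulr1 expr1n.
rewrite -{1}(subnK jd) exprD -[RHS]mulr1 -e; ring.
Qed.

(** The equation for the leading coefficient c is lam^d c^2 = 1; for odd d it
    exhibits lam as a square. *)
Lemma num_recip_fixed_nonsquare lam d : lam != 0 -> odd d ->
  (forall mu, lam != mu ^+ 2) -> num_recip_fixed lam d = 0%N.
Proof.
move=> l0 od ns; apply/eqP; rewrite cards_eq0; apply/eqP/setP => f; rewrite !inE.
apply/negP => /and3P[/eqP sf /eqP f1 /(recip_fixP l0 sf)/(_ d (leqnn d))].
rewrite subnn f1 => e.
have fd : f`_d != 0 by apply/eqP => z; move/eqP: e; rewrite z !mul0r eq_sym oner_eq0.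
have /negP := ns ((f`_d * lam ^+ d./2)^-1); apply; apply/eqP.
have dE : d = d./2.*2.+1 by rewrite -[LHS]odd_double_half od.
have e' : lam * (f`_d * lam ^+ d./2) ^+ 2 = 1.
  have eL : lam ^+ d = lam * (lam ^+ d./2 * lam ^+ d./2).
    by rewrite {1}dE -addnn exprS exprD.
  by rewrite -[RHS]e eL; ring.
have nz : f`_d * lam ^+ d./2 != 0 by rewrite mulf_neq0 ?expf_neq0.
by rewrite exprVn; apply: (mulIf (expf_neq0 2 nz)); rewrite e' mulVf // expf_neq0.
Qed.

Lemma num_recip_fixed0 lam : lam != 0 -> num_recip_fixed lam 0 = 1%N.
Proof.
move=> l0; apply/eqP/cards1P; exists (npolyp 1 1); apply/setP => f; rewrite !inE.
apply/and3P/eqP => [[/eqP sf /eqP f1 _]|->].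
  apply/val_inj; rewrite /= npolypK ?size_poly1 //.
  by rewrite (size1_polyC (size_npoly f)) f1.
rewrite npolypK ?size_poly1 // coef1; split=> //.
by rewrite recip1.
Qed.

End RecipRoots.

(** * Averaging over the multiplier *)

Section Squares.
Variable F : finFieldType.

Definition is_square (x : F) := [exists y, x == y ^+ 2].

Lemma squareP x : reflect (exists y, x = y ^+ 2) (is_square x).
Proof. by apply: (iffP existsP) => -[y e]; exists y; apply/eqP. Qed.

(** If -1 = 1, then 1 has order 2 in the additive group. *)
Lemma odd_card_neg1 : odd #|F| -> -1 != 1 :> F.
Proof.
apply: contraL => /eqP e.
have o2 : #[(1%R : F)]%g = 2%N.
  apply: nt_prime_order => //; last exact: (oner_neq0 F).
  by rewrite FinRing.zmodXgE mulr2n -{1}e addNr.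
have := order_dvdG (in_setT (1%R : F)); rewrite o2 cardsT.
by rewrite dvdn2.
Qed.

(** Squaring is two-to-one on nonzero elements when y and -y differ. *)
Lemma card_squares_neg1 : -1 != 1 :> F ->
  (#|[set x : F | (x != 0%R) && is_square x]| * 2 = #|F|.-1)%N.
Proof.
move=> n1; have <- : #|[set y : F | y != 0%R]| = #|F|.-1.
  by rewrite -cardsT (cardsD1 0 [set: F]) inE /=; apply: eq_card => y; rewrite !inE andbT.
rewrite -[RHS]sum1_card.
rewrite (partition_big (fun y => y ^+ 2) (fun x => (x != 0) && is_square x)) /=; last first.
  by move=> y; rewrite inE expf_eq0 => /negPf->; apply/squareP; exists y.
rewrite -sum1_card big_distrl /=; apply: eq_big => x; first by rewrite inE.
rewrite inE => /andP[x0 /squareP[y ey]]; rewrite mul1n sum1_card.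
have y0 : y != 0 by apply: contra x0 => /eqP y0; rewrite ey y0 expr0n.
have yN : y != - y.
  apply: contra n1 => /eqP e; apply/eqP/(mulIf y0).
  by rewrite mulN1r mul1r -e.
rewrite -[LHS]/(true.+1) -yN -cards2; apply: eq_card => t; rewrite !inE unfold_in /= inE.
rewrite ey eqf_sqr andb_idl // => /orP[]/eqP->; by rewrite ?oppr_eq0.
Qed.

Lemma card_squares : odd #|F| ->
  (#|[set x : F | (x != 0%R) && is_square x]| * 2 = #|F|.-1)%N.
Proof. by move/odd_card_neg1/card_squares_neg1. Qed.

(** When q is even -1 = 1, so squaring is injective, hence bijective. *)
Lemma even_card_square : ~~ odd #|F| -> forall x, is_square x.
Proof.
move=> ev; have n1 : -1 = 1 :> F.
  apply/eqP; apply: contraR ev => /card_squares_neg1 e.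
  have : (0 < #|F|)%N by apply/card_gt0P; exists 0.
  by lia.
have inj : injective (fun y : F => y ^+ 2).
  move=> y t /eqP; rewrite eqf_sqr => /orP[]/eqP-> //.
  by rewrite -mulN1r n1 mul1r.
by move=> x; apply/squareP; exists (invF inj x); exact: esym (f_invF inj x).
Qed.
End Squares.

Section CountTypes.
Variables (F : finFieldType) (n' : nat).
Notation n := n'.+1.

(** Sort the fixed class types by the degrees of their entries, which are the
    multiplicities of a partition of n. *)
Lemma card_recip_types lam : lam != 0 ->
  #|[set u in ctypes F n' | ctype_recip lam u == u]| =
  (\sum_(nu : multiplicities n | weight nu == n) \prod_(i < n) num_recip_fixed lam (nu i))%N.
Proof.
move=> l0.
pose degs (u : {ffun 'I_n -> {poly_n.+1 F}}) : multiplicities n :=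
  [ffun i => inord (size (u i : {poly F})).-1].
have degsE u i : degs u i = (size (u i : {poly F})).-1 :> nat.
  by rewrite ffunE inordK // ltnS -subn1 leq_subLR size_npoly.
rewrite -sum1_card (partition_big degs (fun nu => weight nu == n)) /=; last first.
  move=> u; rewrite !inE => /andP[/andP[_ /eqP e] _]; apply/eqP; rewrite -[RHS]e.
  by apply: eq_bigr => i _; rewrite degsE.
apply: eq_bigr => nu /eqP w; rewrite sum1_card.
have -> : (\prod_(i < n) num_recip_fixed lam (nu i) =
    #|family (fun i => mem (recip_fixed n.+1 lam (nu i)))|)%N.
  rewrite card_family foldrE big_map big_enum /=; apply: eq_bigr => i _.
  by rewrite -(card_recip_fixed lam (ltn_ord (nu i))).
apply: eq_card => u; rewrite unfold_in /=.
apply/andP/familyP => [[uS /eqP du] i|uf].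
  move: uS; rewrite inE => /andP[uU /eqP e].
  have u1 := ctype_coef0 uU i; rewrite -du !inE degsE prednK ?size_poly_gt0 ?coef0_neq0 //.
  by rewrite eqxx u1 eqxx /= -ctype_recipE // e.
have h i : [/\ size (u i : {poly F}) = (nu i).+1, (u i : {poly F})`_0 = 1 & recip lam (u i) = u i].
  by have := uf i; rewrite !inE => /and3P[/eqP ? /eqP ? /eqP ?].
have uU : u \in ctypes F n'.
  rewrite inE; apply/andP; split; first by apply/forallP => i; have [_ -> _] := h i.
  by rewrite -[X in _ == X]w; apply/eqP/eq_bigr => i _; have [-> _ _] := h i.
split; last first.
  by apply/eqP/ffunP => i; apply/val_inj; rewrite /= degsE; have [-> _ _] := h i.
rewrite inE uU; apply/eqP/ffunP => i; apply/val_inj; rewrite /= ctype_recipE //.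
by have [_ _ ->] := h i.
Qed.

(** When sigma is 0, either every lam is a square or every part nu i is even,
    and all the q - 1 multipliers give the same product. Otherwise q is odd
    and some part is odd, so the nonsquares contribute nothing and the
    squares, half of the multipliers, all contribute the same. *)
Lemma sum_num_recip_fixed (nu : multiplicities n) : weight nu = n ->
  ((\sum_(lam : F | lam != 0%R) \prod_(i < n) num_recip_fixed lam (nu i)) * 2 ^ sigma #|F| nu =
   #|F|.-1 * \prod_(i < n | 0 < nu i) num_self_reciprocal F (nu i))%N.
Proof.
move=> w.
have -> : (\prod_(i < n | 0 < nu i) num_self_reciprocal F (nu i) =
    \prod_(i < n) num_recip_fixed (1 : F) (nu i))%N.
  rewrite [LHS]big_mkcond; apply: eq_bigr => i _; case: ltnP => [_|].
    exact: num_self_reciprocalE.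
  by rewrite leqn0 => /eqP->; rewrite num_recip_fixed0 // oner_neq0.
set P := (\prod_(i < n) num_recip_fixed (1 : F) (nu i))%N.
have F0 : #|[set x : F | x != 0%R]| = #|F|.-1.
  by rewrite -cardsT (cardsD1 0 [set: F]) inE /=; apply: eq_card => y; rewrite !inE andbT.
have sumP (A : pred F) : (\sum_(lam : F | A lam) P = #|[set x | A x]| * P)%N.
  by rewrite sum_nat_const cardsE.
have sq (lam : F) : lam != 0 -> is_square lam -> (\prod_(i < n) num_recip_fixed lam (nu i))%N = P.
  move=> l0 /squareP[mu e]; apply: eq_bigr => i _; rewrite e.
  apply: num_recip_fixed_square; apply/eqP => m0.
  by move: l0; rewrite e m0 expr0n eqxx.
set g := (\big[gcdn/0]_(i < n) (nu i : nat))%N.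
have gdvd i : (g %| nu i)%N by apply: biggcdn_inf (dvdnn _).
have g0 : (0 < g)%N.
  rewrite lt0n; apply/eqP => g0; move: w; rewrite /weight big1 // => i _.
  by have := gdvd i; rewrite g0 dvd0n => /eqP->; rewrite muln0.
have F_gt0 : (0 < #|F|)%N by apply/card_gt0P; exists 0.
have sE : sigma #|F| nu = (odd g && odd #|F|)%N :> nat.
  rewrite /sigma -/g p_part_gt1 mem_primes /= muln_gt0 part_gt0 F_gt0 /=.
  rewrite dvdn2 oddM negb_and.
  have -> : odd (g`_2)%N = odd g.
    by rewrite p_part oddX orbF -leqn0 leqNgt logn_gt0 mem_primes /= g0 dvdn2 negbK.
  by case: (odd g); case: (odd #|F|).
rewrite sE.
have [ev|od] := boolP (~~ odd #|F|).
  rewrite (negPf ev) andbF muln1 -F0 -sumP; apply: eq_bigr => lam l0.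
  by apply: sq => //; apply: even_card_square.
rewrite negbK in od; rewrite od andbT.
have [eg|og] := boolP (~~ odd g).
  rewrite (negPf eg) muln1 -F0 -sumP; apply: eq_bigr => lam l0.
  apply: eq_bigr => i _; apply: num_recip_fixed_even => //; rewrite -dvdn2.
  by apply: dvdn_trans (gdvd i); rewrite dvdn2.
rewrite negbK in og; rewrite og expn1.
have [i oi] : exists i, odd (nu i).
  apply/existsP; apply: contraLR og; rewrite negb_exists => /forallP h.
  rewrite -dvdn2; apply/dvdn_biggcdP => i _; by rewrite dvdn2.
rewrite (bigID (@is_square F)) /= [X in (_ + X)%N]big1 ?addn0; last first.
  move=> lam /andP[l0 nsq]; rewrite (bigD1 i) //= num_recip_fixed_nonsquare // => mu.
  by apply: contra nsq => /eqP->; apply/squareP; exists mu.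
rewrite (eq_bigr (fun=> P)) => [|lam /andP[l0 l1]]; last exact: sq.
by rewrite sumP mulnAC card_squares.
Qed.
End CountTypes.

(** * The general linear group and its centre *)

Section GL.
Variables (F : finFieldType) (n' : nat).
Notation n := n'.+1.
Notation G := 'GL_n[F]%g.
Notation Z := ('Z('GL_n[F]%g))%G.
Implicit Types (x y z : {'GL_n[F]}).

Definition glmx x : 'M[F]_n := GLval x.

Lemma glmxM x y : glmx (x * y)%g = glmx x *m glmx y. Proof. by []. Qed.
Lemma glmx1 : glmx 1%g = 1%:M. Proof. by []. Qed.
Lemma glmx_inj : injective glmx. Proof. exact: val_inj. Qed.
Lemma glmx_unit x : glmx x \in unitmx. Proof. exact: (valP x). Qed.

Lemma glmx_surj A : A \in unitmx -> exists x, glmx x = A.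
Proof. by move=> uA; exists (FinRing.unit 'M[F]_n uA). Qed.

(** Commuting with the transvections 1 + E_ij forces the matrix to commute
    with every E_ij, i <> j, hence to be scalar. *)
Lemma central_scalar z : z \in 'Z(G)%g <-> exists2 lam, lam != 0 & glmx z = lam%:M.
Proof.
split=> [/centerP[_ cz]|[lam l0 e]]; last first.
  apply/centerP; split; first exact: in_setT.
  by move=> x _; apply: glmx_inj; rewrite !glmxM e scalar_mxC.
have c i j : i != j -> glmx z *m delta_mx i j = delta_mx i j *m glmx z.
  move=> ij; pose E : 'M[F]_n := delta_mx i j.
  have EE : E *m E = 0 by rewrite /E mul_delta_mx_0 // eq_sym.
  have /mulmx1_unit[uE _] : (1%:M + E) *m (1%:M - E) = 1%:M.
    by rewrite mulmxDl !mulmxBr !mul1mx mulmx1 EE subr0 subrK.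
  have [x ex] := glmx_surj uE.
  have := congr1 glmx (cz x (in_setT _)); rewrite !glmxM ex mulmxDl mulmxDr mul1mx mulmx1.
  by move/addrI.
have z0 : glmx z = (glmx z ord0 ord0)%:M.
  apply/matrixP => k l; rewrite mxE; have [<-|kl] := eqVneq k l; last first.
    have := congr1 (fun M : 'M_n => M k k) (c l k _); rewrite eq_sym => /(_ kl).
    rewrite !mxE (bigD1 l) //= big1 ?addr0 => [|i il]; last first.
      by rewrite mxE (negPf il) mulr0.
    rewrite mxE !eqxx mulr1 => ->; rewrite big1 ?mulr0n // => i _.
    by rewrite mxE (negPf kl) mul0r.
  rewrite mulr1n; have [->|k0] := eqVneq k ord0; first by [].
  have := congr1 (fun M : 'M_n => M k ord0) (c k ord0 k0).
  rewrite !mxE (bigD1 k) //= big1 ?addr0 => [|i ik]; last first.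
    by rewrite mxE (negPf ik) mulr0.
  rewrite mxE !eqxx mulr1 => ->; rewrite (bigD1 ord0) //= big1 ?addr0 => [|i i0]; last first.
    by rewrite mxE (negPf i0) andbF mul0r.
  by rewrite mxE !eqxx mul1r.
exists (glmx z ord0 ord0) => //; apply: contraTneq (glmx_unit z) => h.
by rewrite z0 h unitmxE det_scalar expr0n /= unitr0.
Qed.

Lemma sum_center (f : F -> nat) :
  (\sum_(z in 'Z(G)%g) f (glmx z ord0 ord0) = \sum_(lam : F | lam != 0%R) f lam)%N.
Proof.
have [h hE] : exists h : F -> {'GL_n[F]}, forall lam, lam != 0 -> glmx (h lam) = lam%:M.
  apply: (@fin_all_exists _ _ (fun lam x => lam != 0 -> glmx x = lam%:M)) => lam.
  have [->|l0] := eqVneq lam 0; first by exists 1%g.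
  have [|x ex] := @glmx_surj lam%:M; last by exists x.
  by rewrite unitmxE det_scalar unitrX // unitfE.
rewrite (reindex_onto h (fun z => glmx z ord0 ord0)) /=; last first.
  move=> z /central_scalar[lam l0 e]; apply: glmx_inj.
  by rewrite hE e mxE eqxx mulr1n.
have k lam : (h lam \in 'Z(G)%g) && (glmx (h lam) ord0 ord0 == lam) = (lam != 0).
  apply/andP/idP => [[/central_scalar[mu m0 e] /eqP <-]|l0].
    by rewrite e mxE eqxx mulr1n.
  split; first by apply/central_scalar; exists lam; rewrite ?hE.
  by rewrite hE // mxE eqxx mulr1n.
by apply: eq_big => [lam|lam]; [exact: k | case/andP=> _ /eqP->].
Qed.

Lemma conj_glmx x y z : (x ^ y = z)%g <-> glmx x *m glmx y = glmx y *m glmx z.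
Proof.
rewrite -!glmxM; split=> [<-|/glmx_inj e]; first by rewrite conjgE mulKVg.
by rewrite conjgE e mulKg.
Qed.

Lemma glmx_twist x z lam : glmx z = lam%:M -> glmx x *m glmx (z * x^-1)%g = lam%:M.
Proof.
by move=> e; rewrite glmxM e mulmxA scalar_mxC -mulmxA -glmxM mulgV glmx1 mulmx1.
Qed.

(** Sending a class to the class type of a representative is a bijection,
    under which x |-> lam x^-1 becomes the twisted reciprocal. *)
Lemma card_twisted_classes z lam : lam != 0 -> glmx z = lam%:M ->
  #|[set C in classes G | fixes_class (fun x => z * x^-1)%g C]| =
  #|[set u in ctypes F n' | ctype_recip lam u == u]|.
Proof.
move=> l0 ez.
have [T TP] : exists T : {'GL_n[F]} -> {ffun 'I_n -> {poly_n.+1 F}},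
    forall x, T x \in ctypes F n' /\ has_type (glmx x) (T x).
  apply: (@fin_all_exists _ _ (fun x u => u \in ctypes F n' /\ has_type (glmx x) u)) => x.
  by have [u uU ux] := has_type_exists (glmx_unit x); exists u.
have Zz : z \in 'Z(G)%g by apply/central_scalar; exists lam.
have eqv := equivariant_twist Zz.
have TJ x y : (T x = T y) <-> (y \in (x ^: G)%g).
  have [[Ux tx] [Uy ty]] := (TP x, TP y).
  split=> [e|/imsetP[t _ e]].
    rewrite e in tx; have [X uX eX] := similar_has_type tx ty.
    have [t et] := glmx_surj uX; apply/imsetP; exists t; first exact: in_setT.
    by apply/esym/conj_glmx; rewrite et.
  apply: (has_type_unique Ux Uy) ty; apply: has_type_similar tx; first exact: (glmx_unit t).
  by apply/conj_glmx.
have Tz x : T (z * x^-1)%g = ctype_recip lam (T x).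
  have [[Ux tx] [Uz tz]] := (TP x, TP (z * x^-1)%g).
  apply: has_type_unique tz _ => //; first exact: ctype_recip_in.
  by apply: has_type_recip tx => //; apply: glmx_twist.
have Tfix C : C \in classes G ->
    fixes_class (fun x => z * x^-1)%g C = (ctype_recip lam (T (repr C)) == T (repr C)).
  case/repr_classesP => _ eC; rewrite /fixes_class {2}eC -Tz.
  by rewrite eq_sym; apply/idP/eqP => /TJ.
rewrite -(card_in_imset (f := fun C => T (repr C))); last first.
  move=> C D; rewrite !inE => /andP[/repr_classesP[_ eC] _] /andP[/repr_classesP[_ eD] _].
  by move/TJ/class_eqP; rewrite -eC -eD.
apply: eq_card => u; apply/imsetP/idP => [[C]|].
  rewrite inE => /andP[CG]; rewrite Tfix // => e ->.
  by rewrite inE e; have [-> _] := TP (repr C).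
rewrite inE => /andP[uU e]; have [A uA tA] := has_type_realised uU.
have [x ex] := glmx_surj uA; have Tx : T x = u.
  have [Ux tx] := TP x; apply: has_type_unique tx _ => //; by rewrite ex.
have Cx : (x ^: G)%g \in classes G by apply: mem_classes; apply: in_setT.
have Tr : T (repr ((x ^: G)%g)) = u.
  rewrite -Tx; apply/TJ; rewrite class_sym; apply: mem_repr_classes Cx.
by exists (x ^: G)%g; rewrite // inE Cx Tfix // Tr.
Qed.

(** A relation x ^ y = x^-1 in PGL_n lifts to x ^ y = lam x^-1 in GL_n, where
    the conjugating element can be replaced by an involution. *)
Lemma strongly_real_PGL (X : coset_of Z) : X \in PGL n F ->
  real_elt (PGL n F) X -> strongly_real_elt (PGL n F) X.
Proof.
have NG x : x \in 'N(Z)%g by apply: (subsetP (normal_norm (center_normal _))); apply: in_setT.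
case/morphimP => x _ Gx ->; rewrite real_eltE => /imsetP[Y /morphimP[y _ Gy ->] e].
have [z Zz ez] : exists2 z, z \in 'Z(G)%g & (x ^ y = z * x^-1)%g.
  exists (x ^ y * x)%g; last by rewrite mulgK.
  by apply: coset_idr; rewrite ?NG // morphM ?NG //= morphJ ?NG //= -e mulVg.
have [lam l0 ezl] := iffLR (central_scalar z) Zz.
have /conj_glmx ezm := ez.
have [W WW eW] := similar_involution l0 (glmx_twist x ezl) (glmx_unit y) ezm.
have [uW _] := mulmx1_unit WW; have [t et] := glmx_surj uW.
have tt : (t * t = 1)%g by apply: glmx_inj; rewrite glmxM et WW.
have tV : (t^-1 = t)%g by apply/eqP; rewrite eq_invg_mul tt.
have xt : (x ^ t = z * x^-1)%g by apply/conj_glmx; rewrite et.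
apply/exists_inP; exists (coset Z t); first by apply: mem_quotient; apply: in_setT.
apply/andP; split; first by rewrite expgS expg1 -morphM ?NG //= tt morph1.
rewrite -!morphV ?NG //= tV -!morphM ?NG //= -{1}tV -mulgA -conjgE xt.
by rewrite coset_kerl.
Qed.

End GL.

(** * Real classes of PGL_n *)

(** The centre consists of the q - 1 nonzero scalars, so the sum over the
    centre is a sum over multipliers. *)
Lemma card_real_PGL (F : finFieldType) n' (n := n'.+1) :
  (#|F|.-1 * #|[set C in classes (PGL n F) | real_class (PGL n F) C]| =
   \sum_(lam : F | lam != 0%R) #|[set u in ctypes F n' | ctype_recip lam u == u]|)%N.
Proof.
have cardZ : #|'Z('GL_n[F])%g| = #|F|.-1.
  have := sum_center n' (fun _ : F => 1%N); rewrite !sum1_card => ->.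
  by rewrite -cardsT (cardsD1 0 [set: F]) inE /=; apply: eq_card => y; rewrite !inE andbT.
rewrite -cardZ (central_quotient_real_classes (subxx _)).
rewrite -(sum_center n' (fun lam => #|[set u in ctypes F n' | ctype_recip lam u == u]|)).
apply: eq_bigr => z /central_scalar[lam l0 e].
by rewrite (card_twisted_classes l0 e) e mxE eqxx mulr1n.
Qed.

Theorem theorem7p8 (q n : nat) (F : finFieldType) (hq : #|F| = q)
    (hn : (0 < n)%N) :
  (#|[set C in classes (PGL n F) | real_class (PGL n F) C]|%:R
     = \sum_(nu : multiplicities n | weight nu == n)
         (2%:R ^+ sigma q nu)^-1
         * \prod_(i < n | (0 < nu i)%N) (num_self_reciprocal F (nu i))%:R
     :> rat)
  /\ (forall C : {set coset_of ('Z('GL_n[F]))%g},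
        C \in classes (PGL n F) ->
        real_class (PGL n F) C -> strongly_real_class (PGL n F) C).
Proof.
case: n hn => // n' _; split; last first.
  move=> C CG /forall_inP rC; apply/forall_inP => X CX.
  apply: strongly_real_PGL (rC X CX); have [Y GY eC] := imsetP CG.
  by rewrite eC in CX; apply: (subsetP (class_subG GY (subxx _))).
rewrite -hq; have F1 : (#|F|.-1)%:R != 0 :> rat.
  by rewrite Num.Theory.pnatr_eq0 -lt0n -ltnS prednK ?card_finNzRing_gt1 //
    ltnW ?card_finNzRing_gt1.
apply: (mulfI F1); rewrite -natrM card_real_PGL.
under eq_bigr => lam l0 do rewrite (card_recip_types n' l0).
rewrite exchange_big mulr_sumr natr_sum; apply: eq_bigr => nu /eqP w /=.
have s0 : 2%:R ^+ sigma #|F| nu != 0 :> rat by rewrite expf_neq0.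
apply: (mulIf s0); rewrite -natrX -natrM (sum_num_recip_fixed F w) natrM natr_prod.
by rewrite natrX; field.
Qed.
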